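(* Let $\Sigma$ be a nonsingular surface in a 3-dimensional pseudohermitian manifold $(M,J,\theta)$. Then the two CR invariant area elements $dA_1,dA_2$ of $\Sigma$ (defined through the Cartan--Chern connection forms of an adapted coframe) are given by $$dA_1=\Big|e_1(\alpha)+\tfrac12\alpha^2-\mathrm{Im}A_{11}+\tfrac14W+\tfrac16H^2\Big|^{3/2}\theta\wedge e^1,$$ $$dA_2=\Big\{(T+\alpha e_2)(\alpha)+\tfrac23\Big[e_1(\alpha)+\tfrac12\alpha^2-\mathrm{Im}A_{11}+\tfrac14W\Big]H+\tfrac{2}{27}H^3+\mathrm{Im}\Big[\tfrac16W^{,1}+\tfrac{2i}{3}(A^{11})_{,1}\Big]-\alpha\,\mathrm{Re}A_{\bar1}^{1}\Big\}\theta\wedge e^1.$$ In particular, if $M$ is the Heisenberg group $\mathcal H_1$ or the standard pseudohermitian 3-sphere $\mathcal S^3$, then $$dA_1=\Big|e_1(\alpha)+\tfrac12\alpha^2+\tfrac14W+\tfrac16H^2\Big|^{3/2}\theta\wedge e^1,$$ $$dA_2=\Big\{(T+\alpha e_2)(\alpha)+\tfrac23\Big[e_1(\alpha)+\tfrac12\alpha^2+\tfrac14W\Big]H+\tfrac{2}{27}H^3\Big\}\theta\wedge e^1,$$ where $W=0$ for $\mathcal H_1$ and $W=2$ for $\mathcal S^3$.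
   Context: Pseudohermitian notation. $(M,J,\theta)$: $\theta$ is a contact form, $\xi=\ker\theta$, $J:\xi\to\xi$ with $J^2=-\mathrm{Id}$, and the Levi metric $\frac12d\theta(\cdot,J\cdot)$ is positive definite on $\xi$ (convention $d\theta(X,Y)=X\theta(Y)-Y\theta(X)-\theta([X,Y])$). $T$ is the Reeb field: $\theta(T)=1$, $d\theta(T,\cdot)=0$. $\nabla$ is the Tanaka--Webster connection. For an orthonormal frame $e_1,e_2=Je_1$ of $\xi$ let $(e^1,e^2,\theta)$ be dual to $(e_1,e_2,T)$, so $d\theta=2e^1\wedge e^2$; the real 1-form $\omega$ is given by $\nabla e_1=\omega\otimes e_2$, $\nabla e_2=-\omega\otimes e_1$, and $\omega_1^1=i\omega$. With $T_\nabla$ the torsion of $\nabla$, write $T_\nabla(T,e_1)=a_1e_1-a_2e_2$, $T_\nabla(T,e_2)=-a_2e_1-a_1e_2$, $A_{11}=a_1+ia_2$, $A^1_{\bar1}=A^{11}=a_1-ia_2$. $W$ is the Webster curvature, $d\omega(e_1,e_2)=-2W$. With $Z_1=\frac12(e_1-ie_2)$, $Z_{\bar1}=\overline{Z_1}$: $W^{,1}=Z_{\bar1}W$ and $(A^{11})_{,1}=Z_1(A^{11})+2\omega_1^1(Z_1)A^{11}$. Surface. A point $p\in\Sigma$ is singular if $T_p\Sigma=\xi_p$; $\Sigma$ is nonsingular if it has no singular points. On a nonsingular $\Sigma$, $e_1$ is a unit vector field in $T\Sigma\cap\xi$, $e_2=Je_1$, $\alpha$ is the function with $T+\alpha e_2\in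 T\Sigma$, and $H=\omega(e_1)$ is the $p$-mean curvature ($\nabla_{e_1}e_1=He_2$). Cartan--Chern connection. An admissible CR coframe is $(\theta,\tilde\theta^1,\tilde\theta^{\bar1};\tilde\phi)$ where $\tilde\theta^1$ is a complex 1-form restricting to a $(1,0)$-form on $\xi$, $\tilde\phi$ is a real 1-form, and $d\theta=i\tilde\theta^1\wedge\tilde\theta^{\bar1}+\theta\wedge\tilde\phi$. Its connection forms $\tilde\phi_1^1,\tilde\phi^1$ (complex), $\tilde\psi$ (real) are the unique forms with $\tilde\phi_1^1+\overline{\tilde\phi_1^1}=\tilde\phi$ and $d\tilde\theta^1=\tilde\theta^1\wedge\tilde\phi_1^1+\theta\wedge\tilde\phi^1$, $d\tilde\phi=i\tilde\theta^1\wedge\tilde\phi^{\bar1}-i\tilde\theta^{\bar1}\wedge\tilde\phi^1+\theta\wedge\tilde\psi$, $d\tilde\phi_1^1=i\tilde\theta^{\bar1}\wedge\tilde\phi^1-2i\tilde\phi^{\bar1}\wedge\tilde\theta^1-\frac12\tilde\psi\wedge\theta$, $d\tilde\phi^1=\tilde\phi\wedge\tilde\phi^1+\tilde\phi^1\wedge\tilde\phi_1^1-\frac12\tilde\psi\wedge\tilde\theta^1+Q\,\tilde\theta^{\bar1}\wedge\theta$ for some function $Q$ (here $\tilde\phi^{\bar1}=\overline{\tilde\phi^1}$). Area elements. The coframe is adapted to $\Sigma$ if, writing $\tilde\theta^1=\omega^1+i\omega^2$ with $\omega^1,\omega^2$ real, $\omega^2=0$ on $T\Sigma$. Restricting to $\Sigma$,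 the CR second fundamental form coefficients are defined by $\mathrm{Im}\,\tilde\phi_1^1=h_{11}\omega^1+h_{10}\theta$ and $\mathrm{Im}\,\tilde\phi^1=h_{10}\omega^1+h_{00}\theta$. Then $$dA_1:=|h_{10}+\tfrac16h_{11}^2|^{3/2}\theta\wedge\omega^1,\qquad dA_2:=(h_{00}+\tfrac23h_{10}h_{11}+\tfrac2{27}h_{11}^3)\theta\wedge\omega^1;$$ they are CR invariant 2-forms. For definiteness compute them with the adapted coframe $\tilde\theta^1=e^1+i(e^2-\alpha\theta)$, $\tilde\phi=-2\alpha e^1$ (with $e_1,e_2,\alpha$ extended smoothly off $\Sigma$), so $\omega^1=e^1$. Models. $\mathcal H_1=\mathbb R^3$ with $\theta=dt+x\,dy-y\,dx$, $J(\partial_x+y\partial_t)=\partial_y-x\partial_t$. $\mathcal S^3\subset\mathbb C^2$ is the unit sphere with its induced CR structure and $\theta=\sum_{j=1}^2(x_jdy_j-y_jdx_j)$. Both have $A_{11}=0$. *)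

(* Defs.v *)
From HB Require Import structures.
From mathcomp Require Import all_boot all_order all_algebra.
From mathcomp Require Import complex.
From mathcomp Require Import all_classical all_reals all_analysis.

Set Implicit Arguments.
Unset Strict Implicit.
Unset Printing Implicit Defensive.

Import Order.TTheory GRing.Theory Num.Theory.
Import numFieldNormedType.Exports.

Local Open Scope classical_set_scope.
Local Open Scope complex_scope.
Local Open Scope ring_scope.

(* C^k and C^oo real functions on a set A of R^n; A is always open below. *)
Fixpoint Ck (R : realType) (n k : nat) (A : set 'rV[R]_n)
    (f : 'rV[R]_n -> R) : Prop :=
  match k with
  | 0%N => forall x, A x -> {for x, continuous f}
  | k'.+1 => (forall x, A x -> differentiable f x) /\
             (forall i : 'I_n, Ck k' A (fun x => 'D_(delta_mx 0 i) f x))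
  end.

Definition Cinf (R : realType) (n : nat) (A : set 'rV[R]_n)
    (f : 'rV[R]_n -> R) : Prop := forall k, Ck k A f.

Record chart (R : realType) (n : nat) (M : Type) := Chart {
  chart_dom : set M;
  chart_map : M -> 'rV[R]_n;
  chart_inv : 'rV[R]_n -> M }.

Definition chart_img (R : realType) n (M : Type) (c : chart R n M) :
  set 'rV[R]_n := chart_map c @` chart_dom c.

Record manifold (R : realType) (n : nat) := Manifold {
  carrier :> topologicalType;
  atlas : set (chart R n carrier);
  manifold_hausdorff : hausdorff_space carrier;
  manifold_second_countable : @second_countable carrier;
  chart_open : forall c, atlas c -> open (chart_dom c) /\ open (chart_img c);
  chart_mapK : forall c p, atlas c -> chart_dom c p ->
    chart_inv c (chart_map c p) = p;
  chart_continuous : forall c p, atlas c -> chart_dom c p ->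
    {for p, continuous (chart_map c)};
  chart_inv_continuous : forall c x, atlas c -> chart_img c x ->
    {for x, continuous (chart_inv c)};
  atlas_cover : forall p, exists2 c, atlas c & chart_dom c p;
  atlas_compat : forall c c', atlas c -> atlas c' -> forall i : 'I_n,
    Cinf (chart_map c @` (chart_dom c `&` chart_dom c'))
         (fun x => chart_map c' (chart_inv c x) 0 i) }.

Section Calculus.
Variables (R : realType) (n : nat) (M : manifold R n).

Definition smooth_on (V : set M) (f : M -> R) : Prop :=
  forall c, atlas c ->
    Cinf (chart_map c @` (V `&` chart_dom c)) (fun x => f (chart_inv c x)).

Definition smooth_at (p : M) (f : M -> R) : Prop :=
  exists2 V, open_nbhs p V & smooth_on V f.

(* Tangent vectors at p are the derivations at p of the functions that are
   smooth near p.  Since functions here are total, a derivation is extended by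
   0 to the functions that are not smooth near p, so that Leibniz equality of
   functionals is equality of tangent vectors.  Locality follows from the
   Leibniz rule. *)
Definition tvec := (M -> R) -> R.

Definition tangent (p : M) : set tvec := [set v | [/\
  forall (a : R) f g, smooth_at p f -> smooth_at p g ->
    v (fun q => a * f q + g q) = a * v f + v g,
  forall f g, smooth_at p f -> smooth_at p g ->
    v (fun q => f q * g q) = f p * v g + g p * v f &
  forall f, ~ smooth_at p f -> v f = 0]].

Definition field := M -> tvec.

Definition vfield (V : set M) (X : field) : Prop :=
  (forall p, V p -> tangent p (X p)) /\
  (forall W f, open W -> W `<=` V -> smooth_on W f ->
    smooth_on W (fun p => X p f)).

(* The test on f implements the extension by 0 of tangent vectors. *)
Definition lie (X Y : field) : field := fun p f =>
  if `[< smooth_at p f >]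
  then X p (fun q => Y q f) - Y p (fun q => X q f) else 0.

Definition preform1 := M -> tvec -> R.

Definition form1 (V : set M) (eta : preform1) : Prop :=
  (forall p, V p -> forall (a : R) v w, tangent p v -> tangent p w ->
    eta p (a *: v + w) = a * eta p v + eta p w) /\
  (forall W X, open W -> W `<=` V -> vfield W X ->
    smooth_on W (fun p => eta p (X p))).

(* A 2-form is given by its values on vector fields; no factor 1/2 in d. *)
Definition d1 (eta : preform1) (X Y : field) (p : M) : R :=
  X p (fun q => eta q (Y q)) - Y p (fun q => eta q (X q)) - eta p (lie X Y p).

Definition wedge (S : pzRingType) (eta zeta : M -> tvec -> S)
    (p : M) (v w : tvec) : S := eta p v * zeta p w - eta p w * zeta p v.

Definition cpreform1 := M -> tvec -> R[i].

Definition re_form (eta : cpreform1) : preform1 := fun p v => complex.Re (eta p v).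
Definition im_form (eta : cpreform1) : preform1 := fun p v => complex.Im (eta p v).
Definition bar_form (eta : cpreform1) : cpreform1 := fun p v => (eta p v)^*%C.
Definition real_form (eta : preform1) : cpreform1 := fun p v => (eta p v)%:C.

Definition cform1 (V : set M) (eta : cpreform1) : Prop :=
  form1 V (re_form eta) /\ form1 V (im_form eta).

Definition dC (eta : cpreform1) (X Y : field) (p : M) : R[i] :=
  d1 (re_form eta) X Y p +i* d1 (im_form eta) X Y p.

(* The complex vector field X + iY is the pair (X, Y). *)
Definition cfield := (field * field)%type.

Definition bar_field (Z : cfield) : cfield := (Z.1, fun p => - Z.2 p).

Definition cder (Z : cfield) (g : M -> R[i]) (p : M) : R[i] :=
  let u := fun q => complex.Re (g q) in
  let w := fun q => complex.Im (g q) in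
  (Z.1 p u - Z.2 p w) +i* (Z.1 p w + Z.2 p u).

Definition ceval (eta : cpreform1) (Z : cfield) (p : M) : R[i] :=
  eta p (Z.1 p) + 'i%C * eta p (Z.2 p).

(* A connection acts on vector fields defined on any open set. *)
Definition affine_connection (nabla : field -> field -> field) : Prop :=
  forall V : set M, open V -> [/\
    forall X Y, vfield V X -> vfield V Y -> vfield V (nabla X Y),
    forall f X X' Y p, smooth_on V f -> vfield V X -> vfield V X' ->
      vfield V Y -> V p ->
      nabla (fun q => f q *: X q + X' q) Y p = f p *: nabla X Y p + nabla X' Y p,
    forall X Y Y' p, vfield V X -> vfield V Y -> vfield V Y' -> V p ->
      nabla X (fun q => Y q + Y' q) p = nabla X Y p + nabla X Y' p &
    forall f X Y p, smooth_on V f -> vfield V X -> vfield V Y -> V p ->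
      nabla X (fun q => f q *: Y q) p = X p f *: Y p + f p *: nabla X Y p].

Definition torsion (nabla : field -> field -> field) (X Y : field) : field :=
  fun p => nabla X Y p - nabla Y X p - lie X Y p.

(* Embedded hypersurfaces (surfaces when n = 3), as local regular level sets. *)
Definition hypersurface (S : set M) : Prop :=
  forall p, S p -> exists V f, [/\ open_nbhs p V, smooth_on V f,
    S `&` V = [set q | f q = 0] `&` V &
    forall q, (S `&` V) q -> exists2 v, tangent q v & v f != 0].

Definition tangent_to (S : set M) (p : M) : set tvec := [set v |
  tangent p v /\
  forall f, smooth_at p f -> (\forall q \near p, S q -> f q = 0) -> v f = 0].

Definition smooth_embedding (m : nat) (F : M -> 'rV[R]_m) (A : set 'rV[R]_m) :
    Prop := [/\
  forall i : 'I_m, smooth_on setT (fun p => F p 0 i),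
  forall p v, tangent p v -> (forall i : 'I_m, v (fun q => F q 0 i) = 0) -> v = 0,
  injective F,
  range F = A &
  forall O : set M, open O -> exists2 O', open O' & F @` O = O' `&` A].

End Calculus.

Section Pseudohermitian.
Variables (R : realType) (M : manifold R 3).

Definition xi (theta : preform1 M) (p : M) : set (tvec M) :=
  [set v | tangent p v /\ theta p v = 0].

Definition hfield (theta : preform1 M) (V : set M) (X : field M) : Prop :=
  vfield V X /\ forall p, V p -> theta p (X p) = 0.

Definition levi (theta : preform1 M) (J : M -> tvec M -> tvec M)
    (X Y : field M) (p : M) : R := d1 theta X (fun q => J q (Y q)) p / 2.

(* J p is only meaningful on xi theta p. *)
Record pseudohermitian := Pseudohermitian {
  theta : preform1 M;
  J : M -> tvec M -> tvec M;
  theta_form : form1 setT theta;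
  theta_contact : forall p, exists V X Y Z, [/\ open_nbhs p V,
    [/\ vfield V X, vfield V Y & vfield V Z] &
    theta p (X p) * d1 theta Y Z p + theta p (Y p) * d1 theta Z X p
      + theta p (Z p) * d1 theta X Y p != 0];
  J_xi : forall p v, xi theta p v -> xi theta p (J p v);
  J_linear : forall p (a : R) v w, xi theta p v -> xi theta p w ->
    J p (a *: v + w) = a *: J p v + J p w;
  J_sq : forall p v, xi theta p v -> J p (J p v) = - v;
  J_smooth : forall V X, open V -> hfield theta V X ->
    vfield V (fun p => J p (X p));
  levi_pos : forall V X p, open V -> hfield theta V X -> V p -> X p != 0 ->
    0 < levi theta J X X p }.

Variable P : pseudohermitian.
Local Notation th := (theta P).
Local Notation thC := (real_form th).

Definition reeb (T : field M) : Prop := [/\ vfield setT T,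
  forall p, th p (T p) = 1 &
  forall V X p, open V -> vfield V X -> V p -> d1 th T X p = 0].

Definition tanaka_webster (T : field M)
    (nabla : field M -> field M -> field M) : Prop :=
  let JX (X : field M) : field M := fun q => J P q (X q) in
  affine_connection nabla /\
  forall V : set M, open V ->
    [/\ forall X Y p, vfield V X -> hfield th V Y -> V p ->
        th p (nabla X Y p) = 0 /\ nabla X (JX Y) p = J P p (nabla X Y p),
      forall X Y Z p, vfield V X -> hfield th V Y -> hfield th V Z -> V p ->
        X p (fun q => levi th (J P) Y Z q)
        = levi th (J P) (nabla X Y) Z p + levi th (J P) Y (nabla X Z) p,
      forall X p, vfield V X -> V p -> nabla X T p = 0,
      forall X Y p, hfield th V X -> hfield th V Y -> V p ->
        torsion nabla X Y p = d1 th X Y p *: T p &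
      forall X p, hfield th V X -> V p ->
        torsion nabla T (JX X) p = - J P p (torsion nabla T X p)].

Definition orthonormal_frame (V : set M) (e1 e2 : field M) : Prop := [/\
  hfield th V e1, hfield th V e2,
  forall p, V p -> e2 p = J P p (e1 p),
  forall p, V p -> [/\ levi th (J P) e1 e1 p = 1,
    levi th (J P) e2 e2 p = 1 & levi th (J P) e1 e2 p = 0] &
  forall p v, V p -> xi th p v -> exists a b : R, v = a *: e1 p + b *: e2 p].

Definition dual_coframe (V : set M) (T e1 e2 : field M)
    (f1 f2 : preform1 M) : Prop := [/\ form1 V f1, form1 V f2 &
  forall p, V p -> [/\ f1 p (e1 p) = 1, f1 p (e2 p) = 0 & f1 p (T p) = 0] /\
                   [/\ f2 p (e1 p) = 0, f2 p (e2 p) = 1 & f2 p (T p) = 0]].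

Definition connection_form (V : set M) (nabla : field M -> field M -> field M)
    (e1 e2 : field M) (omega : preform1 M) : Prop := form1 V omega /\
  forall X p, vfield V X -> V p -> nabla X e1 p = omega p (X p) *: e2 p /\
                                   nabla X e2 p = - (omega p (X p) *: e1 p).

Definition torsion_coefficients (V : set M)
    (nabla : field M -> field M -> field M) (T e1 e2 : field M)
    (a1 a2 : M -> R) : Prop := forall p, V p ->
  torsion nabla T e1 p = a1 p *: e1 p - a2 p *: e2 p /\
  torsion nabla T e2 p = - (a2 p *: e1 p) - a1 p *: e2 p.

Definition Z1 (e1 e2 : field M) : cfield M :=
  (fun p => 2^-1 *: e1 p, fun p => - (2^-1 *: e2 p)).

Definition nonsingular (S : set M) : Prop :=
  forall p, S p -> tangent_to S p <> xi th p.

Definition admissible_coframe (V : set M) (th1 : cpreform1 M)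
    (phi : preform1 M) : Prop := [/\ cform1 V th1, form1 V phi,
  forall p v, V p -> xi th p v -> th1 p (J P p v) = 'i%C * th1 p v &
  forall X Y p, vfield V X -> vfield V Y -> V p ->
    (d1 th X Y p)%:C = 'i%C * wedge th1 (bar_form th1) p (X p) (Y p)
                       + wedge thC (real_form phi) p (X p) (Y p)].

Definition cartan_chern_forms (V : set M) (th1 : cpreform1 M)
    (phi : preform1 M) (phi11 phi1 : cpreform1 M) (psi : preform1 M) : Prop :=
  let th1b := bar_form th1 in
  let phi1b := bar_form phi1 in
  let phiC := real_form phi in
  let psiC := real_form psi in
  [/\ [/\ cform1 V phi11, cform1 V phi1 & form1 V psi],
    forall p v, V p -> tangent p v ->
      phi11 p v + (phi11 p v)^*%C = (phi p v)%:C &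
    exists Q : M -> R[i], forall (X Y : field M) p,
      vfield V X -> vfield V Y -> V p ->
      let wd := fun eta zeta : cpreform1 M => wedge eta zeta p (X p) (Y p) in
      [/\ dC th1 X Y p = wd th1 phi11 + wd thC phi1,
          dC phiC X Y p = 'i%C * wd th1 phi1b - 'i%C * wd th1b phi1 + wd thC psiC,
          dC phi11 X Y p = 'i%C * wd th1b phi1 - 2 * 'i%C * wd phi1b th1
                           - 2^-1 * wd psiC thC &
          dC phi1 X Y p = wd phiC phi1 + wd phi1 phi11 - 2^-1 * wd psiC th1
                          + Q p * wd th1b thC]].

Definition adapted_coframe (S V : set M) (th1 : cpreform1 M) : Prop :=
  forall p v, (S `&` V) p -> tangent_to S p v -> im_form th1 p v = 0.

Definition second_fundamental_form (S V : set M) (th1 phi11 phi1 : cpreform1 M)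
    (h11 h10 h00 : M -> R) : Prop :=
  forall p v, (S `&` V) p -> tangent_to S p v ->
    im_form phi11 p v = h11 p * re_form th1 p v + h10 p * th p v /\
    im_form phi1 p v = h10 p * re_form th1 p v + h00 p * th p v.

(* dA1, dA2 are the CR area 2-forms of S over V, computed with the coframe
   (theta, th1; phi); as forms on S they are evaluated on T_p S only. *)
Definition CR_area_elements (S V : set M) (th1 : cpreform1 M)
    (phi : preform1 M) (dA1 dA2 : M -> tvec M -> tvec M -> R) : Prop :=
  exists phi11 phi1 psi h11 h10 h00,
    [/\ admissible_coframe V th1 phi, adapted_coframe S V th1,
        cartan_chern_forms V th1 phi phi11 phi1 psi,
        second_fundamental_form S V th1 phi11 phi1 h11 h10 h00 &
        forall p v w, (S `&` V) p -> tangent_to S p v -> tangent_to S p w ->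
          dA1 p v w = `|h10 p + h11 p ^+ 2 / 6| `^ (3 / 2)
                      * wedge th (re_form th1) p v w /\
          dA2 p v w = (h00 p + 2 / 3 * h10 p * h11 p + 2 / 27 * h11 p ^+ 3)
                      * wedge th (re_form th1) p v w].

(* The two models are described through an identification F of M with
   R^3, resp. with the unit sphere of C^2 = R^4 (coordinates x1,y1,x2,y2). *)
Definition is_heisenberg : Prop := exists F : M -> 'rV[R]_3,
  let x := fun p => F p 0 (inord 0) in
  let y := fun p => F p 0 (inord 1) in
  let t := fun p => F p 0 (inord 2) in
  [/\ smooth_embedding F setT,
    forall p v, tangent p v -> th p v = v t + x p * v y - y p * v x &
    (* J (d/dx + y d/dt) = d/dy - x d/dt *)
    forall p v, tangent p v -> v x = 1 -> v y = 0 -> v t = y p ->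
      [/\ J P p v x = 0, J P p v y = 1 & J P p v t = - x p]].

Definition is_sphere : Prop := exists F : M -> 'rV[R]_4,
  let x1 := fun p => F p 0 (inord 0) in
  let y1 := fun p => F p 0 (inord 1) in
  let x2 := fun p => F p 0 (inord 2) in
  let y2 := fun p => F p 0 (inord 3) in
  [/\ smooth_embedding F [set z | \sum_(k < 4) z 0 k ^+ 2 = 1],
    forall p v, tangent p v ->
      th p v = (x1 p * v y1 - y1 p * v x1) + (x2 p * v y2 - y2 p * v x2) &
    (* J is multiplication by i in C^2 *)
    forall p v, xi th p v ->
      [/\ J P p v x1 = - v y1, J P p v y1 = v x1,
          J P p v x2 = - v y2 & J P p v y2 = v x2]].

End Pseudohermitian.

(* Main.v *)
Require Import Defs.
From HB Require Import structures.
From mathcomp Require Import all_boot all_order all_algebra.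
From mathcomp Require Import complex.
From mathcomp Require Import all_classical all_reals all_analysis.
From mathcomp Require Import ring lra.

Set Implicit Arguments.
Unset Strict Implicit.
Unset Printing Implicit Defensive.

Import Order.TTheory GRing.Theory Num.Theory.
Import numFieldNormedType.Exports.

Local Open Scope classical_set_scope.
Local Open Scope complex_scope.
Local Open Scope ring_scope.

(** The CR invariants of a surface only involve the Cartan--Chern forms
    [phi11], [phi1] along the surface, and those can be read off the structure
    equations by evaluating them on the frame [(e1, e2, T)].

    The Tanaka--Webster axioms give the brackets of the frame ([lie12], [lie1T],
    [lie2T]) in terms of [omega] and the torsion [a1, a2], hence the value of [d]
    of every 1-form on the frame.  Write [g = f2 - alpha theta] for the imaginary
    part of the coframe and [phi11 = - alpha f1 + i lam], [phi1 = mu + i nu].  The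
    equation for [d th1] gives [lam e1 = H] and [lam e2 = omega e2 - 3 alpha], and
    expresses [mu e2] and [nu e1] through [lam T] ([first_structure_equations]).
    The imaginary part of the equation for [d phi11] is
      [d lam = 3 (f1 /\ mu + g /\ nu)];
    on [(e1, e2)] it determines
      [lam T = omega T + 3/2 alpha^2 + W/4],
    and therefore [h10 = nu e1]; on [(e2, T)] its right-hand side is
    [3 nu (T + alpha e2) = 3 h00], and its left-hand side contains
    [d omega (e2, T)], which the Jacobi identity for the frame turns into the
    divergence of the torsion ([bianchi]).

    In the two models there is a CR function [zeta = x + i y] with
    [T zeta = i k zeta], where [k] is 0 or 1: the coordinate [x + i y] of the
    Heisenberg group, or whichever of the two coordinates of the sphere is not
    stationary along [e1] at the given point.  Put [b = e1 zeta]; then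
    [|b|^2 = 1 - k |zeta|^2].  Since [e1 + i e2] and [T] multiply [zeta] by the
    constants 0 and [i k], the bracket [[T, e1 + i e2]] kills [zeta], and this
    says [(a2 + i a1) b = 0].  The remaining brackets together with the norm of
    [b] give all the first derivatives of [b], and comparing [[e1, e2] b] with the
    second derivatives gives [W = 2 k] ([cr_function_curvature]). *)

(** * Smooth functions *)

Section EuclideanSmoothness.
Variables (R : realType) (n : nat).
Implicit Types (A B : set 'rV[R]_n) (f g : 'rV[R]_n -> R).

(** The difference of the two functions vanishes near [x], hence is negligible
    to first order there. *)
Lemma near_eq_differentiable f g x :
  (\forall y \near x, f y = g y) -> differentiable f x -> differentiable g x.
Proof.
move=> fg df.
have h0 : differentiable (g - f) x.
  have hx : (g - f) x = 0 by rewrite !fctE (nbhs_singleton fg) subrr.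
  have o0 : (g - f) \o shift x = cst ((g - f) x) + \0 +o_ 0 id.
    apply/eqaddoP => _/posnumP[e].
    rewrite hx; near=> y.
    rewrite !fctE /=.
    rewrite (_ : f (y + x) = g (y + x)) ?subrr ?addr0 ?subr0 ?normr0 ?mulr_ge0//.
    near: y.
    by move: fg; rewrite (near_shift 0 x) subr0; apply.
  have d0 : 'd (g - f) x = \0 :> ('rV[R]_n -> R).
    by apply: diff_unique => //; exact: cst_continuous.
  apply/diff_locallyP; rewrite d0; split => //; exact: cst_continuous.
have -> : g = f + (g - f) by rewrite addrC subrK.
exact: differentiableD.
Unshelve. all: by end_near. Qed.

Lemma near_eq_continuous f g x :
  (\forall y \near x, f y = g y) -> {for x, continuous f} ->
  {for x, continuous g}.
Proof.
move=> fg cf; rewrite /prop_for /continuous_at -(nbhs_singleton fg).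
exact: cvg_trans (near_eq_cvg fg) cf.
Qed.

Lemma Ck_sub k A B f : B `<=` A -> Ck k A f -> Ck k B f.
Proof.
move=> BA; elim: k f => [|k IH] f /=; first by move=> h x /BA /h.
by move=> [df Df]; split=> [x /BA /df //|i]; exact: IH.
Qed.

Lemma Ck_eq k A f g : open A -> (forall x, A x -> f x = g x) ->
  Ck k A f -> Ck k A g.
Proof.
move=> oA; elim: k f g => [|k IH] f g fg /=.
  move=> h x Ax; apply: near_eq_continuous (h x Ax).
  by apply: filterS fg _; exact: open_nbhs_nbhs.
move=> [df Df]; split=> [x Ax|i].
  apply: near_eq_differentiable (df x Ax).
  by apply: filterS fg _; exact: open_nbhs_nbhs.
apply: IH (Df i) => x Ax; apply: near_eq_derive.
by apply: filterS fg _; exact: open_nbhs_nbhs.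
Qed.

Lemma CkS k A f : Ck k.+1 A f -> Ck k A f.
Proof.
elim: k f => [|k IH] f.
  by move=> [df _] x /df; exact: differentiable_continuous.
by move=> [df Df]; split=> // i; exact: IH.
Qed.

Lemma Ck_cst k A (a : R) : Ck k A (fun=> a).
Proof.
elim: k a => [|k IH] a /=; first by move=> x _; exact: cst_continuous.
split=> [x _|i]; first exact: differentiable_cst.
have -> : (fun x : 'rV[R]_n => 'D_(delta_mx 0 i) (fun=> a) x) = (fun=> 0 : R).
  apply/funext => x; exact: derive_cst.
exact: IH.
Qed.

Lemma CkD k A f g : open A -> Ck k A f -> Ck k A g ->
  Ck k A (fun x => f x + g x).
Proof.
move=> oA; elim: k f g => [|k IH] f g /=.
  by move=> hf hg x Ax; exact: (cvgD (hf x Ax) (hg x Ax)).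
move=> [df Df] [dg Dg]; split=> [x Ax|i].
  by apply: differentiableD; [exact: df | exact: dg].
apply: Ck_eq (IH _ _ (Df i) (Dg i)) => // x Ax.
by rewrite -deriveD //; apply: diff_derivable; [exact: df | exact: dg].
Qed.

Lemma CkM k A f g : open A -> Ck k A f -> Ck k A g ->
  Ck k A (fun x => f x * g x).
Proof.
move=> oA; elim: k f g => [|k IH] f g.
  by move=> hf hg x Ax; exact: (cvgM (hf x Ax) (hg x Ax)).
move=> Cf Cg; have [df Df] := Cf; have [dg Dg] := Cg; split=> [x Ax|i].
  by apply: differentiableM; [exact: df | exact: dg].
apply: (Ck_eq oA _ (CkD oA (IH _ _ (CkS Cf) (Dg i)) (IH _ _ (CkS Cg) (Df i)))).
move=> x Ax.
by rewrite -deriveM //; apply: diff_derivable; [exact: df | exact: dg].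
Qed.

End EuclideanSmoothness.

Section SmoothFunctions.
Variables (R : realType) (n : nat) (M : manifold R n).
Implicit Types (V W : set M) (f g : M -> R) (p q : M).

Lemma open_chart_image (c : chart R n M) V : atlas c -> open V ->
  open (chart_map c @` (V `&` chart_dom c)).
Proof.
move=> ac oV; have [oD oI] := chart_open ac.
rewrite openE => _ [q [Vq Dq] <-]; rewrite /interior.
have Iq : chart_img c (chart_map c q) by exists q.
have cq := chart_inv_continuous ac Iq.
have nV : nbhs (chart_inv c (chart_map c q)) V.
  by rewrite (chart_mapK ac Dq); exact: open_nbhs_nbhs.
have nI : nbhs (chart_map c q) (chart_img c) by exact: open_nbhs_nbhs.
apply: filterS2 nI (cq _ nV) => x [r Dr <-] /=.
by rewrite (chart_mapK ac Dr) => Vr; exists r.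
Qed.

Lemma smooth_on_sub V W f : W `<=` V -> smooth_on V f -> smooth_on W f.
Proof.
move=> WV h c ac k; apply: Ck_sub (h c ac k).
by apply: image_subset => q [/WV].
Qed.

Lemma smooth_on_eq V f g : open V -> (forall q, V q -> f q = g q) ->
  smooth_on V f -> smooth_on V g.
Proof.
move=> oV fg h c ac k; apply: Ck_eq (h c ac k); first exact: open_chart_image.
by move=> _ [q [Vq Dq] <-]; rewrite (chart_mapK ac Dq) fg.
Qed.

Lemma smooth_on_cst V (a : R) : smooth_on V (fun=> a).
Proof. by move=> c _ k; exact: Ck_cst. Qed.

Lemma smooth_onD V f g : open V -> smooth_on V f -> smooth_on V g ->
  smooth_on V (fun q => f q + g q).
Proof.
by move=> oV hf hg c ac k; apply: CkD (hf c ac k) (hg c ac k);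
  exact: open_chart_image.
Qed.

Lemma smooth_onM V f g : open V -> smooth_on V f -> smooth_on V g ->
  smooth_on V (fun q => f q * g q).
Proof.
by move=> oV hf hg c ac k; apply: CkM (hf c ac k) (hg c ac k);
  exact: open_chart_image.
Qed.

Lemma smooth_onZ V (a : R) f : open V -> smooth_on V f ->
  smooth_on V (fun q => a * f q).
Proof. by move=> oV; exact/smooth_onM/smooth_on_cst. Qed.

Lemma smooth_onN V f : open V -> smooth_on V f -> smooth_on V (fun q => - f q).
Proof.
move=> oV /(smooth_onZ (-1) oV); apply: smooth_on_eq => // q _.
exact: mulN1r.
Qed.

Lemma smooth_onB V f g : open V -> smooth_on V f -> smooth_on V g ->
  smooth_on V (fun q => f q - g q).
Proof. by move=> oV hf hg; apply: smooth_onD => //; exact: smooth_onN. Qed.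

Lemma smooth_on_at V f p : open V -> smooth_on V f -> V p -> smooth_at p f.
Proof. by move=> oV h Vp; exists V. Qed.

Lemma smooth_at_common f g p : smooth_at p f -> smooth_at p g ->
  exists V, [/\ open V, V p, smooth_on V f & smooth_on V g].
Proof.
move=> [V [oV Vp] hf] [W [oW Wp] hg]; exists (V `&` W); split=> //.
- exact: openI.
- by apply: smooth_on_sub hf => q [].
- by apply: smooth_on_sub hg => q [].
Qed.

Lemma smooth_at_eq p f g : (\forall q \near p, f q = g q) ->
  smooth_at p f -> smooth_at p g.
Proof.
move=> nfg; have := nfg : nbhs p _; rewrite nbhsE => -[W [oW Wp] fg] [V [oV Vp] hf].
exists (V `&` W); first by split; [exact: openI | split].
apply: (@smooth_on_eq _ f); [exact: openI | by move=> q [_ /fg] |].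
by apply: smooth_on_sub hf => q [].
Qed.

Lemma smooth_at_cst p (a : R) : smooth_at p (fun=> a).
Proof. by apply: (@smooth_on_at setT) => //; [exact: openT | exact: smooth_on_cst]. Qed.

Lemma smooth_atD p f g : smooth_at p f -> smooth_at p g ->
  smooth_at p (fun q => f q + g q).
Proof.
move=> hf hg; have [V [oV Vp sf sg]] := smooth_at_common hf hg.
exact: (smooth_on_at oV (smooth_onD oV sf sg)).
Qed.

Lemma smooth_atM p f g : smooth_at p f -> smooth_at p g ->
  smooth_at p (fun q => f q * g q).
Proof.
move=> hf hg; have [V [oV Vp sf sg]] := smooth_at_common hf hg.
exact: (smooth_on_at oV (smooth_onM oV sf sg)).
Qed.

Lemma smooth_atN p f : smooth_at p f -> smooth_at p (fun q => - f q).
Proof. by move=> [V [oV Vp] h]; exact: (smooth_on_at oV (smooth_onN oV h)). Qed.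

Lemma smooth_atB p f g : smooth_at p f -> smooth_at p g ->
  smooth_at p (fun q => f q - g q).
Proof. by move=> hf hg; apply: smooth_atD => //; exact: smooth_atN. Qed.

End SmoothFunctions.

(** * Derivations and vector fields *)

Section TangentVectors.
Variables (R : realType) (n : nat) (M : manifold R n).
Implicit Types (V W : set M) (f g : M -> R) (p q : M) (v w : tvec M).

Lemma tangentL p v (a : R) f g : tangent p v -> smooth_at p f -> smooth_at p g ->
  v (fun q => a * f q + g q) = a * v f + v g.
Proof. by move=> [h _ _]; exact: h. Qed.

Lemma tangentM p v f g : tangent p v -> smooth_at p f -> smooth_at p g ->
  v (fun q => f q * g q) = f p * v g + g p * v f.
Proof. by move=> [_ h _]; exact: h. Qed.

Lemma tangentD p v f g : tangent p v -> smooth_at p f -> smooth_at p g ->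
  v (fun q => f q + g q) = v f + v g.
Proof.
move=> tv sf sg; rewrite -[v f]mul1r -(tangentL 1 tv sf sg).
by congr v; apply/funext => q; rewrite mul1r.
Qed.

Lemma tangent_cst p v (a : R) : tangent p v -> v (fun=> a) = 0.
Proof.
move=> tv.
have s1 := smooth_at_cst p (1 : R).
have v1 : v (fun=> 1) = 0.
  have /= := tangentM tv s1 s1; rewrite !mul1r.
  by move/eqP; rewrite -subr_eq0 opprD addrA subrr sub0r oppr_eq0 => /eqP.
have v0 : v (fun=> 0) = 0.
  have s0 := smooth_at_cst p (0 : R); have /= := tangentD tv s0 s0; rewrite addr0.
  by move/eqP; rewrite -subr_eq0 opprD addrA subrr sub0r oppr_eq0 => /eqP.
have := tangentL a tv s1 (smooth_at_cst p 0); by rewrite /= v0 v1 mulr0 !addr0 mulr1.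
Qed.

Lemma tangentN p v f : tangent p v -> smooth_at p f -> v (fun q => - f q) = - v f.
Proof.
move=> tv sf; have := tangentL (-1) tv sf (smooth_at_cst p 0).
rewrite (tangent_cst 0 tv) addr0 mulN1r => <-.
by congr v; apply/funext => q; rewrite addr0 mulN1r.
Qed.

Lemma tangentB p v f g : tangent p v -> smooth_at p f -> smooth_at p g ->
  v (fun q => f q - g q) = v f - v g.
Proof.
by move=> tv sf sg; rewrite (tangentD tv sf (smooth_atN sg)) (tangentN tv sg).
Qed.

Lemma tangentZ p v (a : R) f : tangent p v -> smooth_at p f ->
  v (fun q => a * f q) = a * v f.
Proof.
move=> tv sf; rewrite (tangentM tv (smooth_at_cst p a) sf).
by rewrite (tangent_cst a tv) mulr0 addr0.
Qed.

(** A derivation only sees germs. As smoothness at [p] is itself a condition on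
    germs, the indicator function of a neighbourhood of [p] is smooth at [p], so
    it can play the part of a cut-off function in the Leibniz rule. *)
Lemma tangent_local p v f g : tangent p v -> (\forall q \near p, f q = g q) ->
  v f = v g.
Proof.
move=> tv fg; have [_ _ v0] := tv.
have gf : \forall q \near p, g q = f q by apply: filterS fg.
have [sf|nf] := pselect (smooth_at p f); last first.
  by rewrite !v0 // => /(smooth_at_eq gf).
have sg := smooth_at_eq fg sf.
pose chi q : R := (`[< f q = g q >])%:R.
have chi1 : \forall q \near p, 1 = chi q.
  by apply: filterS fg => q fgq; rewrite /chi asboolT.
have schi : smooth_at p chi by apply: smooth_at_eq chi1 (smooth_at_cst p 1).
have := tangentM tv schi (smooth_atB sf sg).
rewrite (_ : (fun q => chi q * _) = fun=> 0); last first.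
  apply/funext => q; rewrite /chi; case: asboolP => [->|_].
    by rewrite subrr mulr0.
  by rewrite mul0r.
rewrite (tangent_cst 0 tv) -(nbhs_singleton chi1) (nbhs_singleton fg) subrr.
rewrite mul0r addr0 mul1r (tangentB tv sf sg) => /eqP.
by rewrite eq_sym subr_eq0 => /eqP.
Qed.

Lemma tangent_lin p (a : R) v w : tangent p v -> tangent p w ->
  tangent p (a *: v + w).
Proof.
move=> tv tw; split.
- move=> b f g sf sg; rewrite !fctE /= !(tangentL b _ sf sg) //.
  by rewrite /GRing.scale /=; ring.
- move=> f g sf sg; rewrite !fctE /= !(tangentM _ sf sg) //.
  by rewrite /GRing.scale /=; ring.
- move=> f nf; have [_ _ v0] := tv; have [_ _ w0] := tw.
  by rewrite !fctE /= v0 // w0 // scaler0 addr0.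
Qed.

Lemma tangent0 p : tangent p (0 : tvec M).
Proof.
have z f : (0 : tvec M) f = 0 by [].
by split=> [a f g _ _|f g _ _|f _]; rewrite !z ?mulr0 ?addr0.
Qed.

Lemma tangent_scale p (a : R) v : tangent p v -> tangent p (a *: v).
Proof. by move=> tv; rewrite -[_ *: _]addr0; exact/tangent_lin/tangent0. Qed.

Lemma tangent_add p v w : tangent p v -> tangent p w -> tangent p (v + w).
Proof. by move=> tv tw; rewrite -[v]scale1r; exact: tangent_lin. Qed.

End TangentVectors.

Section VectorFields.
Variables (R : realType) (n : nat) (M : manifold R n).
Implicit Types (V W : set M) (f g : M -> R) (p q : M) (X Y Z : field M).

Lemma vfield_sub V W X : W `<=` V -> vfield V X -> vfield W X.
Proof.
move=> WV [tX sX]; split=> [p /WV /tX //|O f oO OW]; apply: sX => //.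
exact: subset_trans WV.
Qed.

Lemma vfield_tangent V X p : vfield V X -> V p -> tangent p (X p).
Proof. by move=> [h _]; exact: h. Qed.

Lemma vfield_smooth V X f : open V -> vfield V X -> smooth_on V f ->
  smooth_on V (fun p => X p f).
Proof. by move=> oV [_ h]; exact: h. Qed.

Lemma vfield_smooth_at V X f p : open V -> vfield V X -> V p ->
  smooth_at p f -> smooth_at p (fun p => X p f).
Proof.
move=> oV vX Vp [W [oW Wp] sf].
have oVW : open (V `&` W) by exact: openI.
apply: (smooth_on_at oVW _ (conj Vp Wp)); apply: vfield_smooth => //.
- by apply: vfield_sub vX => q [].
- by apply: smooth_on_sub sf => q [].
Qed.

Lemma lie_at X Y f p : smooth_at p f ->
  lie X Y p f = X p (fun q => Y q f) - Y p (fun q => X q f).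
Proof. by move=> sf; rewrite /lie asboolT. Qed.

Lemma near_open V (Q : M -> Prop) p : open V -> V p ->
  (forall q, V q -> Q q) -> \forall q \near p, Q q.
Proof. by move=> oV Vp h; apply: filterS h _; exact: open_nbhs_nbhs. Qed.

Lemma tangent_eq_on V p v f g : open V -> V p -> tangent p v ->
  (forall q, V q -> f q = g q) -> v f = v g.
Proof. by move=> oV Vp tv fg; apply: (tangent_local tv); exact: near_open oV Vp fg. Qed.

Lemma tangent_cst_on V p v f (c : R) : open V -> V p -> tangent p v ->
  (forall q, V q -> f q = c) -> v f = 0.
Proof. by move=> oV Vp tv /(tangent_eq_on oV Vp tv) ->; exact: tangent_cst tv. Qed.

Lemma lie_tangent V X Y p : open V -> vfield V X -> vfield V Y -> V p ->
  tangent p (lie X Y p).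
Proof.
move=> oV vX vY Vp.
have tX := vfield_tangent vX Vp; have tY := vfield_tangent vY Vp.
have sX f : smooth_at p f -> smooth_at p (fun q => X q f).
  exact: (vfield_smooth_at oV vX Vp).
have sY f : smooth_at p f -> smooth_at p (fun q => Y q f).
  exact: (vfield_smooth_at oV vY Vp).
split=> [a f g sf sg|f g sf sg|f nf]; last by rewrite /lie asboolF.
- have sa := smooth_at_cst p a.
  have [W [oW Wp sWf sWg]] := smooth_at_common sf sg.
  have L Z : vfield V Z -> \forall q \near p,
      Z q (fun r => a * f r + g r) = a * Z q f + Z q g.
    move=> vZ; apply: (near_open (openI oV oW)) => // q [Vq Wq].
    by apply: tangentL; [exact: vfield_tangent Vq | exists W | exists W].
  rewrite !lie_at //; last by apply: smooth_atD => //; exact: smooth_atM.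
  rewrite (tangent_local tX (L _ vY)) (tangent_local tY (L _ vX)).
  rewrite (tangentL a tX (sY _ sf) (sY _ sg)) (tangentL a tY (sX _ sf) (sX _ sg)).
  ring.
- have [W [oW Wp sWf sWg]] := smooth_at_common sf sg.
  have L Z : vfield V Z -> \forall q \near p,
      Z q (fun r => f r * g r) = f q * Z q g + g q * Z q f.
    move=> vZ; apply: (near_open (openI oV oW)) => // q [Vq Wq].
    by apply: tangentM; [exact: vfield_tangent Vq | exists W | exists W].
  rewrite !lie_at //; last exact: smooth_atM.
  rewrite (tangent_local tX (L _ vY)) (tangent_local tY (L _ vX)).
  have sM h k : smooth_at p h -> smooth_at p k ->
      smooth_at p (fun q => h q * k q) by exact: smooth_atM.
  rewrite (tangentD tX (sM _ _ sf (sY _ sg)) (sM _ _ sg (sY _ sf))).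
  rewrite (tangentD tY (sM _ _ sf (sX _ sg)) (sM _ _ sg (sX _ sf))).
  rewrite (tangentM tX sf (sY _ sg)) (tangentM tX sg (sY _ sf)).
  rewrite (tangentM tY sf (sX _ sg)) (tangentM tY sg (sX _ sf)).
  ring.
Qed.

Lemma lie_vfield V X Y : open V -> vfield V X -> vfield V Y ->
  vfield V (lie X Y).
Proof.
move=> oV vX vY; split=> [p Vp|W f oW WV sf]; first exact: lie_tangent Vp.
have vXW := vfield_sub WV vX; have vYW := vfield_sub WV vY.
apply: (@smooth_on_eq _ _ _ _ (fun p => X p (fun q => Y q f) - Y p (fun q => X q f))) => //.
  by move=> q Wq; rewrite lie_at //; exists W.
by apply: smooth_onB => //; do 2! apply: vfield_smooth => //.
Qed.

Lemma vfieldD V X Y : open V -> vfield V X -> vfield V Y ->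
  vfield V (fun p => X p + Y p).
Proof.
move=> oV vX vY; split=> [p Vp|W f oW WV sf].
  by apply: tangent_add; exact: vfield_tangent Vp.
have vXW := vfield_sub WV vX; have vYW := vfield_sub WV vY.
by apply: smooth_onD => //; exact: vfield_smooth.
Qed.

Lemma vfieldZ V f X : open V -> smooth_on V f -> vfield V X ->
  vfield V (fun p => f p *: X p).
Proof.
move=> oV sf vX; split=> [p Vp|W g oW WV sg].
  by apply: tangent_scale; exact: vfield_tangent Vp.
have vXW := vfield_sub WV vX; have sfW := smooth_on_sub WV sf.
by apply: smooth_onM => //; exact: vfield_smooth.
Qed.

Lemma lieC X Y p : lie X Y p = - lie Y X p.
Proof.
by apply/funext => f; rewrite /lie fctE; case: asboolP => _; rewrite ?opprB ?oppr0.
Qed.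

Lemma lieD V X Y Z p : open V -> vfield V X -> vfield V Y -> vfield V Z -> V p ->
  lie X (fun q => Y q + Z q) p = lie X Y p + lie X Z p.
Proof.
move=> oV vX vY vZ Vp; apply/funext => f; rewrite /lie !fctE.
case: asboolP => [sf|_]; last by rewrite addr0.
have -> : X p (fun q => (Y q + Z q) f) =
    X p (fun q => Y q f) + X p (fun q => Z q f).
  apply: tangentD; first exact: vfield_tangent Vp.
  - exact: (vfield_smooth_at oV vY Vp).
  - exact: (vfield_smooth_at oV vZ Vp).
ring.
Qed.

Lemma lieZ V g X Y p : open V -> smooth_on V g -> vfield V X -> vfield V Y ->
  V p -> lie X (fun q => g q *: Y q) p = X p g *: Y p + g p *: lie X Y p.
Proof.
move=> oV sg vX vY Vp; apply/funext => f; rewrite /lie !fctE.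
case: asboolP => [sf|nf]; last first.
  by have [_ _ ->] := vfield_tangent vY Vp; rewrite // !scaler0 addr0.
have -> : X p (fun q => (g q *: Y q) f) =
    g p * X p (fun q => Y q f) + Y p f * X p g.
  apply: tangentM; first exact: vfield_tangent Vp.
  - by exists V.
  - exact: (vfield_smooth_at oV vY Vp).
by rewrite /GRing.scale /= /GRing.scale /=; ring.
Qed.

Lemma lie_local V X Y Z p : open V -> vfield V X -> V p ->
  (forall q, V q -> Y q = Z q) -> lie X Y p = lie X Z p.
Proof.
move=> oV vX Vp YZ; apply/funext => f; rewrite /lie; case: asboolP => // _.
rewrite (YZ _ Vp); congr (_ - _).
apply: (tangent_local (vfield_tangent vX Vp)).
by apply: (near_open oV) => // q Vq; rewrite YZ.
Qed.

Lemma lie_jacobi V X Y Z p : open V -> vfield V X -> vfield V Y -> vfield V Z ->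
  V p -> lie X (lie Y Z) p + lie Y (lie Z X) p + lie Z (lie X Y) p = 0.
Proof.
move=> oV vX vY vZ Vp; apply/funext => f; rewrite !fctE.
have [sf|nf] := pselect (smooth_at p f); last by rewrite /lie asboolF // !addr0.
have E A B C : vfield V A -> vfield V B -> vfield V C ->
    lie A (lie B C) p f = A p (fun q => B q (fun r => C r f))
      - A p (fun q => C q (fun r => B r f)) - lie B C p (fun q => A q f).
  move=> vA vB vC; rewrite lie_at //; congr (_ - _).
  have [W [oW Wp] sW] := sf.
  rewrite -(tangentB (vfield_tangent vA Vp)); first last.
  - exact/(vfield_smooth_at oV vC Vp)/(vfield_smooth_at oV vB Vp).
  - exact/(vfield_smooth_at oV vB Vp)/(vfield_smooth_at oV vC Vp).
  apply: (tangent_local (vfield_tangent vA Vp)).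
  apply: (near_open (openI oV oW)) => // q [Vq Wq].
  by rewrite lie_at //; exists W.
have s A := @vfield_smooth_at V A f p oV.
rewrite !E // !lie_at; try by apply: s.
rewrite (_ : (0 : tvec M) f = 0) //; ring.
Qed.

End VectorFields.
(** * One-forms and their differentials *)

Section Forms.
Variables (R : realType) (n : nat) (M : manifold R n).
Variables (V : set M) (eta : preform1 M) (p : M).
Hypotheses (heta : form1 V eta) (Vp : V p).
Implicit Types v w : tvec M.

Lemma form1L (a : R) v w : tangent p v -> tangent p w ->
  eta p (a *: v + w) = a * eta p v + eta p w.
Proof. by move=> tv tw; have [h _] := heta; exact: h. Qed.

Lemma form10 : eta p 0 = 0.
Proof.
have := form1L (-1) (tangent0 p) (tangent0 p).
by rewrite scaler0 addr0 mulN1r addNr.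
Qed.

Lemma form1D v w : tangent p v -> tangent p w -> eta p (v + w) = eta p v + eta p w.
Proof. by move=> tv tw; rewrite -{1}[v]scale1r form1L // mul1r. Qed.

Lemma form1Z (a : R) v : tangent p v -> eta p (a *: v) = a * eta p v.
Proof.
by move=> tv; rewrite -[_ *: _]addr0 (form1L a tv (tangent0 p)) form10 addr0.
Qed.

Lemma form1N v : tangent p v -> eta p (- v) = - eta p v.
Proof. by move=> tv; rewrite -scaleN1r form1Z // mulN1r. Qed.

End Forms.

Lemma form_smooth (R : realType) n (M : manifold R n) (V : set M) eta X :
  open V -> form1 V eta -> vfield V X -> smooth_on V (fun p => eta p (X p)).
Proof. by move=> oV [_ h]; exact: h. Qed.

Lemma form1_sub (R : realType) n (M : manifold R n) (V W : set M) eta :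
  W `<=` V -> form1 V eta -> form1 W eta.
Proof.
move=> WV [h1 h2]; split=> [p /WV|O X oO OW]; first exact: h1.
exact/h2/(subset_trans OW WV).
Qed.

Section CoordinateForms.
Variables (R : realType) (n : nat) (M : manifold R n).

Lemma smooth_on_sum (I : Type) (r : seq I) (V : set M) (f : I -> M -> R) :
  open V -> (forall i, smooth_on V (f i)) ->
  smooth_on V (fun q => \sum_(i <- r) f i q).
Proof.
move=> oV sf; elim: r => [|i r IH].
  rewrite (_ : (fun q => _) = fun=> 0); first exact: smooth_on_cst.
  by apply/funext => q; rewrite big_nil.
rewrite (_ : (fun q => _) = fun q => f i q + \sum_(j <- r) f j q).
  exact: smooth_onD.
by apply/funext => q; rewrite big_cons.
Qed.

Lemma tangent_sum (I : Type) (r : seq I) (V : set M) p v (f : I -> M -> R) :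
  open V -> V p -> tangent p v -> (forall i, smooth_on V (f i)) ->
  v (fun q => \sum_(i <- r) f i q) = \sum_(i <- r) v (f i).
Proof.
move=> oV Vp tv sf; elim: r => [|i r IH].
  rewrite (_ : (fun q => _) = fun=> 0); first by rewrite big_nil (tangent_cst 0 tv).
  by apply/funext => q; rewrite big_nil.
rewrite big_cons -IH -(tangentD tv).
- by congr v; apply/funext => q; rewrite big_cons.
- exact: (smooth_on_at oV (sf i) Vp).
- exact: (smooth_on_at oV (smooth_on_sum r oV sf) Vp).
Qed.

(** The familiar [d (sum_i a_i db_i) = sum_i da_i /\ db_i]: the second derivatives
    of the [b_i] cancel against the bracket. *)
Lemma d1_coord m (V : set M) (eta : preform1 M) (a b : 'I_m -> M -> R) X Y p :
  open V -> V p -> vfield V X -> vfield V Y ->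
  (forall i, smooth_on V (a i)) -> (forall i, smooth_on V (b i)) ->
  (forall q v, V q -> tangent q v -> eta q v = \sum_i a i q * v (b i)) ->
  d1 eta X Y p = \sum_i (X p (a i) * Y p (b i) - Y p (a i) * X p (b i)).
Proof.
move=> oV Vp vX vY sa sb etaE.
have at_ f : smooth_on V f -> smooth_at p f by exact: (smooth_on_at oV ^~ Vp).
have D A B : vfield V A -> vfield V B -> A p (fun q => eta q (B q)) =
    \sum_i (a i p * A p (fun q => B q (b i)) + B p (b i) * A p (a i)).
  move=> vA vB; have tA := vfield_tangent vA Vp.
  have sB i : smooth_on V (fun q => B q (b i)) by exact: vfield_smooth.
  rewrite (tangent_local (g := fun q => \sum_i a i q * B q (b i)) tA).
    rewrite (tangent_sum _ oV Vp tA); last by move=> i; exact: smooth_onM.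
    by apply: eq_bigr => i _; rewrite (tangentM tA (at_ _ (sa i)) (at_ _ (sB i))).
  by apply: (near_open oV Vp) => q Vq; rewrite etaE //; exact: vfield_tangent Vq.
rewrite /d1 (D _ _ vX vY) (D _ _ vY vX) etaE //; last exact: (lie_tangent oV vX vY Vp).
rewrite -!sumrB; apply: eq_bigr => i _; rewrite (lie_at _ _ (at_ _ (sb i))).
ring.
Qed.

End CoordinateForms.

(** * Linear algebra of the models *)

(** The linear system for the first derivatives of [b = u + i s]: two
    equations come from a bracket, two from the norm of [b].  Its determinant is
    [|b|^2] up to sign, and the conclusion is kept in multiplied form so that
    it can be differentiated at a point without first restricting to the open
    set where [b] does not vanish. *)
Lemma norm_system (R : comPzRingType) (u s d1 d2 d3 d4 : R) :
  d2 + d3 = 0 -> d1 - d4 = 0 -> u * d1 + s * d2 = 0 -> u * d3 + s * d4 = 0 ->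
  [/\ (u * u + s * s) * d1 = 0, (u * u + s * s) * d2 = 0,
      (u * u + s * s) * d3 = 0 & (u * u + s * s) * d4 = 0].
Proof.
move=> /addr0_eq e3 /subr0_eq <- {d4} E; rewrite -e3 => F.
have N1 : (u * u + s * s) * d1 = 0.
  rewrite (_ : _ * d1 = u * (u * d1 + s * d2) + s * (u * - d2 + s * d1)); last by ring.
  by rewrite E F; ring.
have N2 : (u * u + s * s) * d2 = 0.
  rewrite (_ : _ * d2 = s * (u * d1 + s * d2) - u * (u * - d2 + s * d1)); last by ring.
  by rewrite E F; ring.
by split=> //; rewrite mulrN N2 oppr0.
Qed.

(** In a Hermitian plane where [z, u] is a unitary basis, the vector [t]
    with [<z, t> = i] and [<u, t> = 0] is [i z], and the rows of the matrix with
    columns [z, u] are unit vectors.  Capital letters stand for the conjugates;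
    treating them as independent variables makes every step a polynomial
    identity. *)
Lemma unitary_basis (C : comPzRingType) (i z1 z2 Z1 Z2 u1 u2 U1 U2 t1 t2 : C) :
  z1 * Z1 + z2 * Z2 = 1 -> Z1 * u1 + Z2 * u2 = 0 -> z1 * U1 + z2 * U2 = 0 ->
  u1 * U1 + u2 * U2 = 1 -> Z1 * t1 + Z2 * t2 = i -> U1 * t1 + U2 * t2 = 0 ->
  [/\ t1 = i * z1, t2 = i * z2, u1 * U1 = 1 - z1 * Z1 & u2 * U2 = 1 - z2 * Z2].
Proof.
move=> N A A' B Tz Tu.
pose b := z1 * u2 - z2 * u1; pose b' := Z1 * U2 - Z2 * U1.
(* [u] is orthogonal to [z], hence a multiple of [(- Z2, Z1)] *)
have u2E : u2 = b * Z1.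
  rewrite (_ : b * Z1 = (z1 * Z1 + z2 * Z2) * u2 - z2 * (Z1 * u1 + Z2 * u2)).
    by rewrite N A; ring.
  by rewrite /b; ring.
have u1E : u1 = - b * Z2.
  rewrite (_ : - b * Z2 = (z1 * Z1 + z2 * Z2) * u1 - z1 * (Z1 * u1 + Z2 * u2)).
    by rewrite N A; ring.
  by rewrite /b; ring.
have U2E : U2 = b' * z1.
  rewrite (_ : b' * z1 = (z1 * Z1 + z2 * Z2) * U2 - Z2 * (z1 * U1 + z2 * U2)).
    by rewrite N A'; ring.
  by rewrite /b'; ring.
have U1E : U1 = - b' * z2.
  rewrite (_ : - b' * z2 = (z1 * Z1 + z2 * Z2) * U1 - Z1 * (z1 * U1 + z2 * U2)).
    by rewrite N A'; ring.
  by rewrite /b'; ring.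
have bb : b * b' = 1.
  rewrite -B u1E u2E U1E U2E (_ : _ + _ = b * b' * (z1 * Z1 + z2 * Z2)); last by ring.
  by rewrite N mulr1.
have zt : z1 * t2 = z2 * t1.
  apply/subr0_eq; rewrite -[LHS]mul1r -bb.
  have -> : b * b' * (z1 * t2 - z2 * t1) = b * (U1 * t1 + U2 * t2).
    by rewrite U1E U2E; ring.
  by rewrite Tu mulr0.
split.
- rewrite -Tz (_ : _ * z1 = (z1 * Z1 + z2 * Z2) * t1 + Z2 * (z1 * t2 - z2 * t1)).
    by rewrite N zt; ring.
  by ring.
- rewrite -Tz (_ : _ * z2 = (z1 * Z1 + z2 * Z2) * t2 - Z1 * (z1 * t2 - z2 * t1)).
    by rewrite N zt; ring.
  by ring.
- rewrite u1E U1E (_ : - b * Z2 * (- b' * z2) = b * b' * (z2 * Z2)); last by ring.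
  by rewrite bb mul1r -N; ring.
- rewrite u2E U2E (_ : b * Z1 * (b' * z1) = b * b' * (z1 * Z1)); last by ring.
  by rewrite bb mul1r -N; ring.
Qed.

(** * Structure equations of the adapted frame *)

Section CartanChern.
Variables (R : realType) (M : manifold R 3) (P : pseudohermitian M).
Local Notation th := (theta P).

(** The structure equations in real form.  In the last one the two terms in
    [th1] and [phi1] are conjugate to each other up to sign, so that their real
    parts add up to the factor 3; [psi] and [Q] disappear. *)
Lemma cartan_chern_real (V : set M) th1 phi phi11 phi1 psi X Y p :
  cartan_chern_forms P V th1 phi phi11 phi1 psi ->
  vfield V X -> vfield V Y -> V p ->
  let wd := fun eta zeta : preform1 M => wedge eta zeta p (X p) (Y p) in
  [/\ d1 (re_form th1) X Y p = wd (re_form th1) (re_form phi11)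
        - wd (im_form th1) (im_form phi11) + wd th (re_form phi1),
      d1 (im_form th1) X Y p = wd (re_form th1) (im_form phi11)
        + wd (im_form th1) (re_form phi11) + wd th (im_form phi1) &
      d1 (im_form phi11) X Y p = 3 * (wd (re_form th1) (re_form phi1)
        + wd (im_form th1) (im_form phi1))].
Proof.
move=> [_ _ [Q hQ]] vX vY Vp wd; have [E1 _ E2 _] := hQ _ _ _ vX vY Vp.
have c2 : 2 = 2 +i* 0 :> R[i] by rewrite complexr0 rmorph_nat.
have ch : 2^-1 = 2^-1 +i* 0 :> R[i] by rewrite complexr0 fmorphV rmorph_nat.
move: E1 E2; rewrite /dC ch c2 /wd /wedge /bar_form /real_form.
move=> E1 E2.
have [A B C] := And3 (congr1 (@complex.Re R) E1) (congr1 (@complex.Im R) E1)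
  (congr1 (@complex.Im R) E2).
move: A B C; clear; rewrite [complex.Re (_ +i* _)]/= ![complex.Im (_ +i* _)]/=.
move=> A B C; split; [rewrite [LHS]A | rewrite [LHS]B | rewrite [LHS]C];
  rewrite /re_form /im_form; clear;
  case: (th1 p (X p)) => ? ?; case: (th1 p (Y p)) => ? ?;
  case: (phi1 p (X p)) => ? ?; case: (phi1 p (Y p)) => ? ?.
- by case: (phi11 p (X p)) => ? ?; case: (phi11 p (Y p)) => ? ? /=; ring.
- by case: (phi11 p (X p)) => ? ?; case: (phi11 p (Y p)) => ? ? /=; ring.
- by rewrite /=; field.
Qed.

End CartanChern.

Section AdaptedFrame.
Variables (R : realType) (M : manifold R 3) (P : pseudohermitian M).
Variables (T : field M) (hT : reeb P T).
Variables (nabla : field M -> field M -> field M).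
Hypothesis hnabla : tanaka_webster P T nabla.
Variables (U : set M) (hU : open U) (e1 e2 : field M).
Hypothesis he : orthonormal_frame P U e1 e2.
Variables (f1 f2 : preform1 M) (hf : dual_coframe U T e1 e2 f1 f2).
Variables (omega : preform1 M) (homega : connection_form U nabla e1 e2 omega).
Variables (a1 a2 : M -> R) (ha : torsion_coefficients U nabla T e1 e2 a1 a2).

Local Notation th := (theta P).
Local Notation H p := (omega p (e1 p)).
Local Notation K p := (omega p (e2 p)).
Local Notation w p := (omega p (T p)).

Lemma frame_vT : vfield U T.
Proof. by case: hT => /(vfield_sub (@subsetT _ U)). Qed.
Lemma frame_v1 : vfield U e1. Proof. by case: he => -[]. Qed.
Lemma frame_v2 : vfield U e2. Proof. by case: he => _ -[]. Qed.
Lemma frame_th : form1 U th.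
Proof. exact: (form1_sub (@subsetT _ U) (theta_form P)). Qed.
Lemma frame_omega : form1 U omega. Proof. by case: homega. Qed.

Let vT := frame_vT.
Let v1 := frame_v1.
Let v2 := frame_v2.
Let fth := frame_th.
Let fom := frame_omega.
Let ff1 : form1 U f1. Proof. by case: hf. Qed.
Let ff2 : form1 U f2. Proof. by case: hf. Qed.

Section AtPoint.
Variables (p : M) (Up : U p).

Lemma frame_t1 : tangent p (e1 p). Proof. exact: vfield_tangent v1 Up. Qed.
Lemma frame_t2 : tangent p (e2 p). Proof. exact: vfield_tangent v2 Up. Qed.
Lemma frame_tT : tangent p (T p). Proof. exact: vfield_tangent vT Up. Qed.

Lemma theta_e1 : th p (e1 p) = 0. Proof. by case: he => -[_ h] *; exact: h. Qed.
Lemma theta_e2 : th p (e2 p) = 0. Proof. by case: he => _ [_ h] *; exact: h. Qed.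
Lemma theta_T : th p (T p) = 1. Proof. by case: hT => _ h _; exact: h. Qed.

Lemma comb_tangent (a b c : R) :
  tangent p (a *: e1 p + b *: e2 p + c *: T p).
Proof.
apply: tangent_add; [apply: tangent_add|]; apply: tangent_scale.
- exact: frame_t1.
- exact: frame_t2.
- exact: frame_tT.
Qed.

Lemma form_comb eta (a b c : R) : form1 U eta ->
  eta p (a *: e1 p + b *: e2 p + c *: T p) =
  a * eta p (e1 p) + b * eta p (e2 p) + c * eta p (T p).
Proof.
move=> feta; rewrite (form1D feta Up); first last.
- exact/tangent_scale/frame_tT.
- apply: tangent_add; apply: tangent_scale; [exact: frame_t1|exact: frame_t2].
rewrite (form1D feta Up); first last.
- exact/tangent_scale/frame_t2.
- exact/tangent_scale/frame_t1.
by rewrite !(form1Z feta Up) //; [exact: frame_tT|exact: frame_t2|exact: frame_t1].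
Qed.

Lemma dtheta12 : d1 th e1 e2 p = 2.
Proof.
have [h1 h2 hJ hL _] := he; have [l11 _ _] := hL _ Up.
have E : d1 th e1 e2 p = d1 th e1 (fun q => J P q (e1 q)) p.
  rewrite /d1 (hJ _ Up); congr (_ - _ - th p _); last exact: (lie_local hU v1 Up hJ).
  apply: (tangent_local frame_t1); apply: (near_open hU Up) => q Uq.
  by rewrite hJ.
by move: l11; rewrite E /levi; lra.
Qed.

Lemma lie12 : lie e1 e2 p = (- H p) *: e1 p + (- K p) *: e2 p + (- 2) *: T p.
Proof.
have [_ hom] := homega; have [h1 h2 _ _ _] := he.
have [_ hTW] := hnabla; have [_ _ _ ht _] := hTW _ hU.
have := ht _ _ _ h1 h2 Up; rewrite /torsion dtheta12.
rewrite (hom _ _ v1 Up).2 (hom _ _ v2 Up).1 => E.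
apply/funext => f; have := congr1 (fun v => v f) E.
rewrite !fctE /GRing.scale /= /GRing.scale /=; lra.
Qed.

Lemma lie1T : lie e1 T p = a1 p *: e1 p + (- (w p + a2 p)) *: e2 p + 0 *: T p.
Proof.
have [_ hom] := homega.
have [_ hTW] := hnabla; have [_ _ hnT _ _] := hTW _ hU.
have := (ha Up).1; rewrite /torsion (hnT _ _ v1 Up) (hom _ _ vT Up).1 => E.
apply/funext => f; have := congr1 (fun v => v f) E.
rewrite lieC !fctE /GRing.scale /= /GRing.scale /=.
rewrite (_ : (0 : tvec M) f = 0) //; lra.
Qed.

Lemma lie2T : lie e2 T p = (w p - a2 p) *: e1 p + (- a1 p) *: e2 p + 0 *: T p.
Proof.
have [_ hom] := homega.
have [_ hTW] := hnabla; have [_ _ hnT _ _] := hTW _ hU.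
have := (ha Up).2; rewrite /torsion (hnT _ _ v2 Up) (hom _ _ vT Up).2 => E.
apply/funext => f; have := congr1 (fun v => v f) E.
rewrite lieC !fctE /GRing.scale /= /GRing.scale /=.
rewrite (_ : (0 : tvec M) f = 0) //; lra.
Qed.

Section StructureEquations.
Variables (eta : preform1 M) (feta : form1 U eta).
Local Notation x q := (eta q (e1 q)).
Local Notation y q := (eta q (e2 q)).
Local Notation z q := (eta q (T q)).

(** Since [omega] and the torsion are exactly what the three brackets
    contain, these formulas are the first structure equations of the
    Tanaka--Webster connection, dualized. *)
Lemma d1_12 : d1 eta e1 e2 p = e1 p (fun q => y q) - e2 p (fun q => x q)
  + H p * x p + K p * y p + 2 * z p.
Proof. by rewrite /d1 lie12 form_comb //; ring. Qed.

Lemma d1_1T : d1 eta e1 T p = e1 p (fun q => z q) - T p (fun q => x q)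
  - a1 p * x p + (w p + a2 p) * y p.
Proof. by rewrite /d1 lie1T form_comb //; ring. Qed.

Lemma d1_2T : d1 eta e2 T p = e2 p (fun q => z q) - T p (fun q => y q)
  - (w p - a2 p) * x p + a1 p * y p.
Proof. by rewrite /d1 lie2T form_comb //; ring. Qed.

End StructureEquations.
End AtPoint.

Lemma frame_smooth (eta : preform1 M) X : form1 U eta -> vfield U X ->
  smooth_on U (fun p => eta p (X p)).
Proof. exact: form_smooth. Qed.

Lemma dual_values p : U p ->
  [/\ f1 p (e1 p) = 1, f1 p (e2 p) = 0 & f1 p (T p) = 0] /\
  [/\ f2 p (e1 p) = 0, f2 p (e2 p) = 1 & f2 p (T p) = 0].
Proof. by case: hf => _ _; apply. Qed.

(** The torsion coefficients enter the Jacobi identity through their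
    derivatives; they are smooth because the brackets of the frame are. *)
Lemma smooth_a1 : smooth_on U a1.
Proof.
apply: (smooth_on_eq hU _ (frame_smooth ff1 (lie_vfield hU v1 vT))) => p Up /=.
rewrite (lie1T Up) (form_comb Up _ _ _ ff1).
by have [[-> -> ->] _] := dual_values Up; ring.
Qed.

Lemma smooth_a2 : smooth_on U a2.
Proof.
have s2 := frame_smooth ff1 (lie_vfield hU v2 vT).
apply: (smooth_on_eq hU _ (smooth_onB hU (frame_smooth fom vT) s2)) => p Up /=.
rewrite (lie2T Up) (form_comb Up _ _ _ ff1).
by have [[-> -> ->] _] := dual_values Up; ring.
Qed.

(** The [e2]-component of the Jacobi identity for the frame; this is the Bianchi
    identity relating the [e2, T] component of the curvature to the divergence
    of the torsion. *)
Lemma bianchi p : U p -> d1 omega e2 T p =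
  e1 p a1 - e2 p a2 + 2 * H p * a2 p + 2 * K p * a1 p.
Proof.
move=> Up.
have sH := frame_smooth fom v1; have sK := frame_smooth fom v2.
have sw := frame_smooth fom vT.
have sa1 := smooth_a1; have sa2 := smooth_a2.
(* the bracket of a field with a combination of the frame, read along [f2]:
   only the coefficient of [e2] is differentiated *)
have B X Y (a b c : M -> R) : vfield U X -> smooth_on U a -> smooth_on U b ->
    smooth_on U c ->
    (forall q, U q -> Y q = a q *: e1 q + b q *: e2 q + c q *: T q) ->
    f2 p (lie X Y p) = a p * f2 p (lie X e1 p) + b p * f2 p (lie X e2 p)
      + c p * f2 p (lie X T p) + X p b.
  move=> vX sa sb sc YE.
  have vfa := vfieldZ hU sa v1; have vfb := vfieldZ hU sb v2.
  have vfc := vfieldZ hU sc vT.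
  have tL Z : vfield U Z -> tangent p (lie X Z p).
    by move=> vZ; exact: lie_tangent hU vX vZ Up.
  have tZ (r : R) v : tangent p v -> tangent p (r *: v) by exact: tangent_scale.
  rewrite (lie_local hU vX Up YE).
  rewrite (lieD hU vX (vfieldD hU vfa vfb) vfc Up) (lieD hU vX vfa vfb Up).
  have dec g Z : vfield U Z -> smooth_on U g ->
      f2 p (lie X (fun q => g q *: Z q) p) =
      X p g * f2 p (Z p) + g p * f2 p (lie X Z p).
    move=> vZ sg; rewrite (lieZ hU sg vX vZ Up) (form1L ff2 Up) ?(form1Z ff2 Up) //.
    - exact: tL.
    - exact: vfield_tangent vZ Up.
    - exact/tZ/tL.
  have td g Z : vfield U Z -> smooth_on U g ->
      tangent p (lie X (fun q => g q *: Z q) p).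
    by move=> vZ sg; exact/tL/vfieldZ.
  rewrite (form1D ff2 Up) ?(form1D ff2 Up) ?dec //; first last.
  - exact: td.
  - by apply: tangent_add; exact: td.
  - exact: td.
  - exact: td.
  by have [_ [-> -> ->]] := dual_values Up; ring.
have lXX X : f2 p (lie X X p) = 0.
  rewrite (_ : lie X X p = 0) ?(form10 ff2 Up) //.
  by apply/funext => f; rewrite /lie subrr if_same.
have J := lie_jacobi hU v1 v2 vT Up.
have t3 A B' C : vfield U A -> vfield U B' -> vfield U C ->
    tangent p (lie A (lie B' C) p).
  by move=> vA vB vC; exact: (lie_tangent hU vA (lie_vfield hU vB vC) Up).
have := congr1 (f2 p) J; rewrite (form10 ff2 Up).
rewrite (form1D ff2 Up) ?(form1D ff2 Up) //; first last;
  [exact: t3 | by apply: tangent_add; exact: t3 | exact: t3 | exact: t3 |].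
have sN g : smooth_on U g -> smooth_on U (fun q => - g q) by exact: smooth_onN.
rewrite (@B _ _ (fun q => w q - a2 q) (fun q => - a1 q) (fun=> 0) v1
  (smooth_onB hU sw sa2) (sN _ sa1) (@smooth_on_cst _ _ _ _ _) lie2T).
rewrite (@B _ _ (fun q => - a1 q) (fun q => w q + a2 q) (fun=> 0) v2
  (sN _ sa1) (smooth_onD hU sw sa2) (@smooth_on_cst _ _ _ _ _)); last first.
  move=> q Uq; rewrite lieC (lie1T Uq).
  by rewrite !scale0r !addr0 opprD -!scaleNr opprK.
rewrite (@B _ _ (fun q => - H q) (fun q => - K q) (fun=> - 2) vT
  (sN _ sH) (sN _ sK) (@smooth_on_cst _ _ _ _ _) lie12).
rewrite !lXX (lieC T) (lieC T) (lieC e2 e1) (lie12 Up) (lie1T Up) (lie2T Up).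
have tc := comb_tangent Up.
rewrite !(form1N ff2 Up (tc _ _ _)) !(form_comb Up _ _ _ ff2).
have [_ [-> -> ->]] := dual_values Up.
have t1 := frame_t1 Up; have t2 := frame_t2 Up; have tT := frame_tT Up.
have at_ g : smooth_on U g -> smooth_at p g by exact: (smooth_on_at hU ^~ Up).
rewrite (tangentN t1 (at_ _ sa1)) (tangentN tT (at_ _ sK)).
rewrite (tangentD t2 (at_ _ sw) (at_ _ sa2)).
rewrite (d1_2T Up fom).
lra.
Qed.

(** * Curvature and torsion of the models *)

Section ModelCurvature.

(** Here [zeta = x + i y] is a CR function, [T zeta = i k zeta] and
    [b = e1 zeta].  The derivatives of [b] are
    [e1 b = i H b - k zeta], [e2 b = i K b + i k zeta], [T b = i (k + w) b],
    so [b] sees the connection form as if it were the differential of its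
    argument, up to a defect proportional to [k]; the integrability condition
    of this system is the value of [d omega (e1, e2)]. *)
Lemma cr_function_curvature (k : R) (x y : M -> R) :
  smooth_on U x -> smooth_on U y ->
  (forall q, U q -> e2 q x = - e1 q y /\ e2 q y = e1 q x) ->
  (forall q, U q -> T q x = - (k * y q) /\ T q y = k * x q) ->
  (forall q, U q -> e1 q x * e1 q x + e1 q y * e1 q y
                    = 1 - k * (x q * x q + y q * y q)) ->
  forall p, U p -> e1 p x * e1 p x + e1 p y * e1 p y != 0 ->
  [/\ a1 p = 0, a2 p = 0 & d1 omega e1 e2 p = - 4 * k].
Proof.
move=> sx sy CR TR NR p0 Up0 N0.
pose u q := e1 q x; pose s q := e1 q y.
have su : smooth_on U u by exact: (vfield_smooth hU v1 sx).
have ss : smooth_on U s by exact: (vfield_smooth hU v1 sy).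
have sH := frame_smooth fom v1; have sK := frame_smooth fom v2.
have A12 q f : U q -> smooth_on U f -> e1 q (fun r => e2 r f) - e2 q (fun r => e1 r f)
    = - H q * e1 q f - K q * e2 q f - 2 * T q f.
  move=> Uq sf; rewrite -(lie_at e1 e2 (smooth_on_at hU sf Uq)) (lie12 Uq) !fctE.
  rewrite /GRing.scale /=; ring.
have A1T q f : U q -> smooth_on U f -> e1 q (fun r => T r f) - T q (fun r => e1 r f)
    = a1 q * e1 q f - (w q + a2 q) * e2 q f.
  move=> Uq sf; rewrite -(lie_at e1 T (smooth_on_at hU sf Uq)) (lie1T Uq) !fctE.
  rewrite /GRing.scale /=; ring.
have A2T q f : U q -> smooth_on U f -> e2 q (fun r => T r f) - T q (fun r => e2 r f)
    = (w q - a2 q) * e1 q f - a1 q * e2 q f.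
  move=> Uq sf; rewrite -(lie_at e2 T (smooth_on_at hU sf Uq)) (lie2T Uq) !fctE.
  rewrite /GRing.scale /=; ring.
have at_ q f : U q -> smooth_on U f -> smooth_at q f.
  by move=> Uq sf; exact: (smooth_on_at hU sf Uq).
have t1 q : U q -> tangent q (e1 q) by exact: frame_t1.
have t2 q : U q -> tangent q (e2 q) by exact: frame_t2.
have tT q : U q -> tangent q (T q) by exact: frame_tT.
have dx q v : U q -> tangent q v -> [/\ v (fun r => e2 r x) = - v s,
    v (fun r => e2 r y) = v u, v (fun r => T r x) = - (k * v y) &
    v (fun r => T r y) = k * v x].
  move=> Uq tv; split.
  - rewrite (tangent_eq_on hU Uq tv (g := fun r => - s r)); last by move=> r /CR[].
    exact: (tangentN tv (at_ _ _ Uq ss)).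
  - by rewrite (tangent_eq_on hU Uq tv (g := u)) // => r /CR[].
  - rewrite (tangent_eq_on hU Uq tv (g := fun r => - (k * y r))); last by move=> r /TR[].
    rewrite (tangentN tv (at_ _ _ Uq (smooth_onZ k hU sy))).
    by rewrite (tangentZ k tv (at_ _ _ Uq sy)).
  - rewrite (tangent_eq_on hU Uq tv (g := fun r => k * x r)); last by move=> r /TR[].
    exact: (tangentZ k tv (at_ _ _ Uq sx)).
(* real and imaginary part of [[T, e1 + i e2] zeta = 0] *)
have tors q : U q -> u q * a1 q + s q * a2 q = 0 /\ s q * a1 q - u q * a2 q = 0.
  move=> Uq; have [c1 c2] := CR q Uq.
  have := (A1T q x Uq sx, A1T q y Uq sy, A2T q x Uq sx, A2T q y Uq sy).
  have [_ _ -> ->] := dx q _ Uq (t1 q Uq); have [_ _ -> ->] := dx q _ Uq (t2 q Uq).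
  have [-> -> _ _] := dx q _ Uq (tT q Uq).
  rewrite c1 c2 -/(u q) -/(s q) -/u -/s => -[[[E1 E2] E3] E4]; split; lra.
have N0' : u p0 * u p0 + s p0 * s p0 != 0 by [].
have mulN0 r : (u p0 * u p0 + s p0 * s p0) * r = 0 -> r = 0.
  by move/eqP; rewrite mulf_eq0 (negbTE N0') /= => /eqP.
have [a10 a20] : a1 p0 = 0 /\ a2 p0 = 0.
  have [T1 T2] := tors p0 Up0; split; apply: mulN0.
    rewrite (_ : _ * _ = u p0 * (u p0 * a1 p0 + s p0 * a2 p0)
      + s p0 * (s p0 * a1 p0 - u p0 * a2 p0)); last by ring.
    by rewrite T1 T2; ring.
  rewrite (_ : _ * _ = s p0 * (u p0 * a1 p0 + s p0 * a2 p0)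
    - u p0 * (s p0 * a1 p0 - u p0 * a2 p0)); last by ring.
  by rewrite T1 T2; ring.
have [Tu Ts] : T p0 u = - ((k + w p0) * s p0) /\ T p0 s = (k + w p0) * u p0.
  have [c1 c2] := CR p0 Up0.
  have := (A1T p0 x Up0 sx, A1T p0 y Up0 sy).
  have [_ _ -> ->] := dx p0 _ Up0 (t1 p0 Up0).
  by rewrite c1 c2 a10 a20 -/(u p0) -/(s p0) -/u -/s => -[E1 E2]; split; lra.
pose N q := u q * u q + s q * s q.
have dN q v : U q -> tangent q v ->
    u q * v u + s q * v s = - k * (x q * v x + y q * v y).
  move=> Uq tv.
  have := tangent_eq_on hU Uq tv (f := N) (g := fun r => 1 - k * (x r * x r + y r * y r)) NR.
  have sxx := smooth_onM hU sx sx; have syy := smooth_onM hU sy sy.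
  have sS := smooth_onD hU sxx syy.
  rewrite (tangentB tv (smooth_at_cst q 1) (at_ _ _ Uq (smooth_onZ k hU sS))).
  rewrite (tangent_cst 1 tv) (tangentZ k tv (at_ _ _ Uq sS)).
  rewrite (tangentD tv (at_ _ _ Uq sxx) (at_ _ _ Uq syy)).
  rewrite (tangentD tv (at_ _ _ Uq (smooth_onM hU su su))
    (at_ _ _ Uq (smooth_onM hU ss ss))).
  have atq f := at_ q f Uq.
  rewrite (tangentM tv (atq _ sx) (atq _ sx)) (tangentM tv (atq _ sy) (atq _ sy)).
  rewrite (tangentM tv (atq _ su) (atq _ su)) (tangentM tv (atq _ ss) (atq _ ss)).
  lra.
(* the defects of [e1 b = i H b - k zeta] and [e2 b = i K b + i k zeta] *)
pose D1 q := e1 q u + (H q * s q + k * x q).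
pose D2 q := e1 q s + (k * y q - H q * u q).
pose D3 q := e2 q u + (K q * s q + k * y q).
pose D4 q := e2 q s + (- k * x q - K q * u q).
have ND q : U q -> [/\ N q * D1 q = 0, N q * D2 q = 0, N q * D3 q = 0 &
    N q * D4 q = 0].
  move=> Uq; have [c1 c2] := CR q Uq; have [r1 r2] := TR q Uq.
  have := (A12 q x Uq sx, A12 q y Uq sy).
  have [-> -> _ _] := dx q _ Uq (t1 q Uq).
  rewrite c1 c2 r1 r2 -/(u q) -/(s q) -/u -/s => -[E1 E2].
  have F1 := dN q _ Uq (t1 q Uq); have F2 := dN q _ Uq (t2 q Uq).
  rewrite c1 c2 -/(u q) -/(s q) in F1 F2.
  apply: norm_system; rewrite /D1 /D2 /D3 /D4; lra.
have sN : smooth_on U N by apply: smooth_onD => //; exact: smooth_onM.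
have jet f : smooth_on U f -> (forall q, U q -> N q * f q = 0) ->
    f p0 = 0 /\ forall v, tangent p0 v -> v f = 0.
  move=> sf Nf; have f0 := mulN0 _ (Nf _ Up0); split=> // v tv; apply: mulN0.
  have := tangent_cst_on hU Up0 tv Nf.
  by rewrite (tangentM tv (at_ _ _ Up0 sN) (at_ _ _ Up0 sf)) f0 mul0r addr0.
have sxy f g h (r : R) : smooth_on U f -> smooth_on U g -> smooth_on U h ->
    smooth_on U (fun q => f q * g q + r * h q).
  by move=> *; apply: smooth_onD => //; [exact: smooth_onM | exact: smooth_onZ].
have sv X f : vfield U X -> smooth_on U f -> smooth_on U (fun q => X q f).
  exact: vfield_smooth.
have sm2 f g h (r : R) : smooth_on U f -> smooth_on U g -> smooth_on U h ->
    smooth_on U (fun q => r * h q - f q * g q).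
  by move=> *; apply: smooth_onB => //; [exact: smooth_onZ | exact: smooth_onM].
have sB1 := sxy _ _ _ k sH ss sx; have sB2 := sm2 _ _ _ k sH su sy.
have sB3 := sxy _ _ _ k sK ss sy; have sB4 := sm2 _ _ _ (- k) sK su sx.
have s1u := sv _ _ v1 su; have s1s := sv _ _ v1 ss.
have s2u := sv _ _ v2 su; have s2s := sv _ _ v2 ss.
(* [N D = 0] on [U] and [N p0 != 0], so each defect vanishes to first order *)
have [D10 J1] := jet D1 (smooth_onD hU s1u sB1) (fun q Uq => let: And4 h _ _ _ := ND q Uq in h).
have [D20 J2] := jet D2 (smooth_onD hU s1s sB2) (fun q Uq => let: And4 _ h _ _ := ND q Uq in h).
have [D30 J3] := jet D3 (smooth_onD hU s2u sB3) (fun q Uq => let: And4 _ _ h _ := ND q Uq in h).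
have [D40 J4] := jet D4 (smooth_onD hU s2s sB4) (fun q Uq => let: And4 _ _ _ h := ND q Uq in h).
have at0 f := at_ p0 f Up0; have t10 := t1 _ Up0; have t20 := t2 _ Up0.
have dA v f g h (r : R) : tangent p0 v -> smooth_on U f -> smooth_on U g ->
    smooth_on U h -> v (fun q => f q * g q + r * h q) =
    f p0 * v g + g p0 * v f + r * v h.
  move=> tv sf sg sh.
  rewrite (tangentD tv (at0 _ (smooth_onM hU sf sg)) (at0 _ (smooth_onZ r hU sh))).
  by rewrite (tangentM tv (at0 _ sf) (at0 _ sg)) (tangentZ r tv (at0 _ sh)).
have dB v f g h (r : R) : tangent p0 v -> smooth_on U f -> smooth_on U g ->
    smooth_on U h -> v (fun q => r * h q - f q * g q) =
    r * v h - (f p0 * v g + g p0 * v f).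
  move=> tv sf sg sh.
  rewrite (tangentB tv (at0 _ (smooth_onZ r hU sh)) (at0 _ (smooth_onM hU sf sg))).
  by rewrite (tangentM tv (at0 _ sf) (at0 _ sg)) (tangentZ r tv (at0 _ sh)).
have {}J1 := J1 _ t20; have {}J2 := J2 _ t20.
have {}J3 := J3 _ t10; have {}J4 := J4 _ t10.
rewrite (tangentD t20 (at0 _ s1u) (at0 _ sB1)) (dA _ _ _ _ k t20 sH ss sx) in J1.
rewrite (tangentD t20 (at0 _ s1s) (at0 _ sB2)) (dB _ _ _ _ k t20 sH su sy) in J2.
rewrite (tangentD t10 (at0 _ s2u) (at0 _ sB3)) (dA _ _ _ _ k t10 sK ss sy) in J3.
rewrite (tangentD t10 (at0 _ s2s) (at0 _ sB4)) (dB _ _ _ _ (- k) t10 sK su sx) in J4.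
have Lu := A12 _ _ Up0 su; have Ls := A12 _ _ Up0 ss.
rewrite Tu in Lu; rewrite Ts in Ls.
have [c1 c2] := CR _ Up0; rewrite c1 c2 in J1 J2.
move: D10 D20 D30 D40; rewrite /D1 /D2 /D3 /D4.
move=> /addr0_eq D10 /addr0_eq D20 /addr0_eq D30 /addr0_eq D40.
split=> //; rewrite (d1_12 Up0 fom); apply/subr0_eq; apply: mulN0.
rewrite -/(u p0) -/(s p0) in J1 J2 J3 J4.
have {D10}p1 : e1 p0 u = - (H p0 * s p0 + k * x p0) by rewrite -D10 opprK.
have {D20}p2 : e1 p0 s = - (k * y p0 - H p0 * u p0) by rewrite -D20 opprK.
have {D30}p3 : e2 p0 u = - (K p0 * s p0 + k * y p0) by rewrite -D30 opprK.
have {D40}p4 : e2 p0 s = - (- k * x p0 - K p0 * u p0) by rewrite -D40 opprK.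
rewrite p1 p3 in Lu; rewrite p2 p4 in Ls.
rewrite p4 in J1; rewrite p3 in J2; rewrite p2 in J3; rewrite p1 in J4.
set X := (X in _ * X = 0).
have sX : s p0 * X = 0 by rewrite /X; lra.
have uX : u p0 * X = 0 by rewrite /X; lra.
rewrite (_ : _ * X = u p0 * (u p0 * X) + s p0 * (s p0 * X)); last by ring.
by rewrite sX uX; ring.
Qed.

End ModelCurvature.

Section Models.

Let J_e2 q : U q -> J P q (e2 q) = - e1 q.
Proof.
move=> Uq; have [[_ h1] _ hJ _ _] := he; rewrite hJ // J_sq //.
by split; [exact: frame_t1 | exact: h1].
Qed.

Lemma J_comb q (a b : R) : U q ->
  J P q (a *: e1 q + b *: e2 q) = a *: e2 q - b *: e1 q.
Proof.
move=> Uq; have [_ _ hJ _ _] := he.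
have x1 : xi th q (e1 q) by split; [exact: frame_t1 | exact: theta_e1].
have x2 : xi th q (e2 q) by split; [exact: frame_t2 | exact: theta_e2].
have x0 : xi th q 0 by split; [exact: tangent0 | exact: (form10 fth Uq)].
have xb : xi th q (b *: e2 q).
  split; first exact/tangent_scale/frame_t2.
  by rewrite (form1Z fth Uq) ?theta_e2 ?mulr0 //; exact: frame_t2.
have J0 : J P q 0 = 0.
  have := J_linear 1 x0 x0; rewrite !scale1r addr0 => E.
  by apply: (addrI (J P q 0)); rewrite -E addr0.
rewrite (J_linear a x1 xb) -hJ //.
have := J_linear b x2 x0; rewrite J0 !addr0 => ->.
by rewrite J_e2 // scalerN.
Qed.

(** The equation [d theta (e1, e2) = 2] says that the [(x, y)]-parts of
    [e1, e2] form a matrix of determinant 1, so the horizontal lift [v] of [d/dx]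
    is a combination of [e1, e2]; the value of [J v] then forces this matrix to
    be a rotation, which is what makes [x + i y] a CR function with [|b| = 1]. *)
Lemma heisenberg_curvature p : is_heisenberg P -> U p ->
  [/\ a1 p = 0, a2 p = 0 & d1 omega e1 e2 p = 0].
Proof.
move=> [F [[sF _ _ _ _] thE JE]] Up.
pose x q := F q 0 (inord 0); pose y q := F q 0 (inord 1).
pose t q := F q 0 (inord 2).
have {}thE q v : tangent q v -> th q v = v t + x q * v y - y q * v x := thE q v.
have {}JE q v : tangent q v -> v x = 1 -> v y = 0 -> v t = y q ->
  [/\ J P q v x = 0, J P q v y = 1 & J P q v t = - x q] := JE q v.
have sU i : smooth_on U (fun q => F q 0 i).
  exact: (smooth_on_sub (@subsetT _ U) (sF i)).
have sx : smooth_on U x := sU _; have sy : smooth_on U y := sU _.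
have st : smooth_on U t := sU _.
(* theta = 1 dt + x dy + (- y) dx *)
pose a (i : 'I_3) := nth (fun=> 0) [:: (fun=> 1); x; (fun q => - y q)] i.
pose b (i : 'I_3) := nth (fun=> 0) [:: t; y; x] i.
have sa i : smooth_on U (a i).
  by case: i => -[|[|[|//]]] ?; [exact: smooth_on_cst | exact: sx | exact: smooth_onN].
have sb i : smooth_on U (b i) by case: i => -[|[|[|//]]].
have dth X Y q : vfield U X -> vfield U Y -> U q ->
    d1 th X Y q = 2 * (X q x * Y q y - Y q x * X q y).
  move=> vX vY Uq; rewrite (d1_coord (a := a) (b := b) hU Uq vX vY sa sb).
    rewrite !big_ord_recl big_ord0 /a /b /=.
    have tX := vfield_tangent vX Uq; have tY := vfield_tangent vY Uq.
    rewrite (tangent_cst 1 tX) (tangent_cst 1 tY).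
    rewrite (tangentN tX (smooth_on_at hU sy Uq)) (tangentN tY (smooth_on_at hU sy Uq)).
    ring.
  by move=> r v _ tv; rewrite (thE r v tv) !big_ord_recl big_ord0 /a /b /=; ring.
have key q : U q -> [/\ e2 q x = - e1 q y, e2 q y = e1 q x, T q x = 0, T q y = 0 &
    e1 q x * e1 q x + e1 q y * e1 q y = 1].
  move=> Uq.
  have := (dtheta12 Uq); rewrite dth // => D.
  have [_ _ rb] := hT.
  have := (rb _ _ _ hU v1 Uq, rb _ _ _ hU v2 Uq); rewrite !dth // => -[R1 R2].
  pose v := e2 q y *: e1 q + (- e1 q y) *: e2 q.
  have tv : tangent q v.
    by apply: tangent_add; apply: tangent_scale; [exact: frame_t1|exact: frame_t2].
  have thv : th q v = 0.
    rewrite (form1D fth Uq) ?(form1Z fth Uq) ?theta_e1 ?theta_e2 ?mulr0 ?addr0 //;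
      try apply: tangent_scale; by [exact: frame_t1|exact: frame_t2].
  have ev f : v f = e2 q y * e1 q f - e1 q y * e2 q f.
    by rewrite /v !fctE /GRing.scale /=; ring.
  have vx : v x = 1 by rewrite ev; lra.
  have vy : v y = 0 by rewrite ev; ring.
  have vt : v t = y q.
    by move: thv; rewrite (thE q v tv) vx vy; lra.
  have [jx jy _] := JE q v tv vx vy vt.
  move: jx jy; rewrite /v (J_comb _ _ Uq) !fctE /GRing.scale /=.
  move: D R1 R2; move: (e1 q x) (e1 q y) (e2 q x) (e2 q y) (T q x) (T q y).
  move=> c s c' s' tx ty D R1 R2 Jx Jy.
  have D' : c * s' - c' * s = 1 by lra.
  have {}Jx : s' * c' + s * c = 0 by lra.
  have {}Jy : s' * s' + s * s = 1 by lra.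
  have cE : c = s'.
    rewrite -[LHS]mulr1 -Jy (_ : c * _ = s' * (c * s' - c' * s)
      + s * (s' * c' + s * c)); last by ring.
    by rewrite D' Jx; ring.
  have c'E : c' = - s.
    rewrite -[LHS]mulr1 -Jy (_ : c' * _ = s' * (s' * c' + s * c)
      - s * (c * s' - c' * s)); last by ring.
    by rewrite D' Jx; ring.
  have R1' : tx * s - c * ty = 0 by lra.
  have R2' : tx * s' - c' * ty = 0 by lra.
  have tx0 : tx = 0.
    rewrite -[LHS]mulr1 -D'
      (_ : _ * _ = c * (tx * s' - c' * ty) - c' * (tx * s - c * ty)); last by ring.
    by rewrite R1' R2'; ring.
  have ty0 : ty = 0.
    rewrite -[LHS]mulr1 -D'
      (_ : _ * _ = s * (tx * s' - c' * ty) - s' * (tx * s - c * ty)); last by ring.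
    by rewrite R1' R2'; ring.
  by split=> //; rewrite cE; move: Jy; lra.
have := @cr_function_curvature 0 x y sx sy.
rewrite mulr0; apply=> // [q /key[] //|q /key[_ _ -> ->]|q /key[_ _ _ _ ->]|].
- by rewrite !mul0r oppr0.
- by rewrite mul0r subr0.
- by have [_ _ _ _ ->] := key _ Up; exact: oner_neq0.
Qed.

(** At each point [(z1, z2)] the vectors [z] and [u = e1 z] form a unitary
    basis of [C^2] and the Reeb field is [i z].  Either of [z1, z2] can serve as
    the CR function, and their derivatives along [e1] are not both 0 because
    [|u| = 1]. *)
Lemma sphere_curvature p : is_sphere P -> U p ->
  [/\ a1 p = 0, a2 p = 0 & d1 omega e1 e2 p = - 4].
Proof.
move=> [F [[sF _ _ rF _] thE JE]] Up.
pose x1 q := F q 0 (inord 0); pose y1 q := F q 0 (inord 1).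
pose x2 q := F q 0 (inord 2); pose y2 q := F q 0 (inord 3).
have {}thE q v : tangent q v -> th q v =
  (x1 q * v y1 - y1 q * v x1) + (x2 q * v y2 - y2 q * v x2) := thE q v.
have {}JE q v : xi th q v -> [/\ J P q v x1 = - v y1, J P q v y1 = v x1,
  J P q v x2 = - v y2 & J P q v y2 = v x2] := JE q v.
have sU i : smooth_on U (fun q => F q 0 i).
  exact: (smooth_on_sub (@subsetT _ U) (sF i)).
have sx1 : smooth_on U x1 := sU _; have sy1 : smooth_on U y1 := sU _.
have sx2 : smooth_on U x2 := sU _; have sy2 : smooth_on U y2 := sU _.
pose a (i : 'I_4) := nth (fun=> 0) [:: x1; (fun q => - y1 q); x2; (fun q => - y2 q)] i.
pose b (i : 'I_4) := nth (fun=> 0) [:: y1; x1; y2; x2] i.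
have sa i : smooth_on U (a i).
  by case: i => -[|[|[|[|//]]]] ?; rewrite /a /=; try exact: smooth_onN.
have sb i : smooth_on U (b i) by case: i => -[|[|[|[|//]]]].
have dth X Y q : vfield U X -> vfield U Y -> U q ->
    d1 th X Y q = 2 * (X q x1 * Y q y1 - Y q x1 * X q y1
                       + (X q x2 * Y q y2 - Y q x2 * X q y2)).
  move=> vX vY Uq; rewrite (d1_coord (a := a) (b := b) hU Uq vX vY sa sb).
    rewrite !big_ord_recl big_ord0 /a /b /=.
    have tX := vfield_tangent vX Uq; have tY := vfield_tangent vY Uq.
    rewrite (tangentN tX (smooth_on_at hU sy1 Uq)) (tangentN tY (smooth_on_at hU sy1 Uq)).
    rewrite (tangentN tX (smooth_on_at hU sy2 Uq)) (tangentN tY (smooth_on_at hU sy2 Uq)).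
    ring.
  by move=> r v _ tv; rewrite (thE r v tv) !big_ord_recl big_ord0 /a /b /=; ring.
have nF q : x1 q * x1 q + y1 q * y1 q + (x2 q * x2 q + y2 q * y2 q) = 1.
  have : range F (F q) by exists q.
  rewrite rF /= => <-; rewrite !big_ord_recl big_ord0.
  rewrite (_ : ord0 = inord 0); last by apply/val_inj; rewrite /= inordK.
  rewrite (_ : lift _ _ = inord 1); last by apply/val_inj; rewrite /= !inordK.
  rewrite (_ : lift _ _ = inord 2); last by apply/val_inj; rewrite /= !inordK.
  rewrite (_ : lift _ _ = inord 3); last by apply/val_inj; rewrite /= !inordK.
  by rewrite /x1 /y1 /x2 /y2; ring.
have nv q v : U q -> tangent q v ->
    x1 q * v x1 + y1 q * v y1 + (x2 q * v x2 + y2 q * v y2) = 0.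
  move=> Uq tv; have := tangent_cst_on hU Uq tv (c := 1) (fun r _ => nF r).
  have at_ f : smooth_on U f -> smooth_at q f by exact: (smooth_on_at hU ^~ Uq).
  have sq f : smooth_on U f -> smooth_on U (fun r => f r * f r).
    by move=> sf; exact: smooth_onM.
  rewrite (tangentD tv (at_ _ (smooth_onD hU (sq _ sx1) (sq _ sy1)))
    (at_ _ (smooth_onD hU (sq _ sx2) (sq _ sy2)))).
  rewrite (tangentD tv (at_ _ (sq _ sx1)) (at_ _ (sq _ sy1))).
  rewrite (tangentD tv (at_ _ (sq _ sx2)) (at_ _ (sq _ sy2))).
  rewrite (tangentM tv (at_ _ sx1) (at_ _ sx1)) (tangentM tv (at_ _ sx2) (at_ _ sx2)).
  rewrite (tangentM tv (at_ _ sy1) (at_ _ sy1)) (tangentM tv (at_ _ sy2) (at_ _ sy2)).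
  lra.
have e2E q : U q -> [/\ e2 q x1 = - e1 q y1, e2 q y1 = e1 q x1,
    e2 q x2 = - e1 q y2 & e2 q y2 = e1 q x2].
  move=> Uq; have [_ _ hJ _ _] := he; rewrite hJ //; apply: JE.
  by split; [exact: frame_t1 | exact: theta_e1].
have key q : U q -> [/\ T q x1 = - y1 q /\ T q y1 = x1 q,
    T q x2 = - y2 q /\ T q y2 = x2 q,
    e1 q x1 * e1 q x1 + e1 q y1 * e1 q y1 = 1 - (x1 q * x1 q + y1 q * y1 q) &
    e1 q x2 * e1 q x2 + e1 q y2 * e1 q y2 = 1 - (x2 q * x2 q + y2 q * y2 q)].
  move=> Uq; have [j1 j2 j3 j4] := e2E q Uq.
  have := dtheta12 Uq; rewrite dth // j1 j2 j3 j4 => D.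
  have [_ _ rb] := hT.
  have := (rb _ _ _ hU v1 Uq, rb _ _ _ hU v2 Uq).
  rewrite !dth // j1 j2 j3 j4 => -[R1 R2].
  have n1 := nv q _ Uq (frame_t1 Uq); have nT := nv q _ Uq (frame_tT Uq).
  have h1 := theta_e1 Uq; rewrite (thE q _ (frame_t1 Uq)) in h1.
  have hT1 := theta_T q; rewrite (thE q _ (frame_tT Uq)) in hT1.
  have N := nF q.
  have := @unitary_basis R[i] 'i%C (x1 q +i* y1 q) (x2 q +i* y2 q)
    (x1 q -i* y1 q) (x2 q -i* y2 q) (e1 q x1 +i* e1 q y1) (e1 q x2 +i* e1 q y2)
    (e1 q x1 -i* e1 q y1) (e1 q x2 -i* e1 q y2)
    (T q x1 +i* T q y1) (T q x2 +i* T q y2).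
  move: D R1 R2 n1 nT h1 hT1 N.
  move: (x1 q) (y1 q) (x2 q) (y2 q) (e1 q x1) (e1 q y1) (e1 q x2) (e1 q y2)
    (T q x1) (T q y1) (T q x2) (T q y2) => c1 s1 c2 s2 u1 w1 u2 w2 p1 q1 p2 q2.
  move=> D R1 R2 n1 nT h1 hT1 N UB.
  have ceq (r r' s s' : R) : r = r' -> s = s' -> r +i* s = r' +i* s'.
    by move=> -> ->.
  case: UB; try (rewrite [LHS]/=; apply: ceq; lra).
  move=> [A1 A2] [B1 B2] [C1 _] [D1 _]; split; try split; lra.
have CRF := @cr_function_curvature 1.
have [b1|b1] := eqVneq (e1 p x1 * e1 p x1 + e1 p y1 * e1 p y1) 0; last first.
  have := CRF x1 y1 sx1 sy1; rewrite mulr1; apply=> //.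
  - by move=> q /e2E[].
  - by move=> q /key[[-> ->] _ _ _]; rewrite !mul1r.
  - by move=> q /key[_ _ -> _]; rewrite mul1r.
have := CRF x2 y2 sx2 sy2; rewrite mulr1; apply=> //.
- by move=> q /e2E[].
- by move=> q /key[_ [-> ->] _ _]; rewrite !mul1r.
- by move=> q /key[_ _ _ ->]; rewrite mul1r.
have [_ _ E1 E2] := key p Up; have N := nF p.
by clear rF; apply/eqP => b2; lra.
Qed.

End Models.

(** * The CR second fundamental form *)

Section SecondFundamentalForm.
Variables (W alpha : M -> R).
Hypotheses (hW : forall p, U p -> d1 omega e1 e2 p = - 2 * W p).
Hypothesis halpha : smooth_on U alpha.
Variables (phi11 phi1 : cpreform1 M) (psi : preform1 M).
Let th1 : cpreform1 M := fun p v => f1 p v +i* (f2 p v - alpha p * th p v).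
Hypothesis hCC : cartan_chern_forms P U th1 (fun p v => - 2 * alpha p * f1 p v)
  phi11 phi1 psi.
Local Notation lam := (im_form phi11).
Local Notation mu := (re_form phi1).
Local Notation nu := (im_form phi1).

Lemma smooth_curvature : smooth_on U W.
Proof.
have sK := vfield_smooth hU v1 (form_smooth hU fom v2).
have sH := vfield_smooth hU v2 (form_smooth hU fom v1).
have sl := form_smooth hU fom (lie_vfield hU v1 v2).
apply: (smooth_on_eq hU _ (smooth_onZ (- 2^-1) hU (smooth_onB hU
  (smooth_onB hU sK sH) sl))) => p Up /=.
have := hW Up; rewrite /d1; lra.
Qed.

Let flam : form1 U lam. Proof. by case: hCC => -[[_ ?] _ _]. Qed.

Lemma re_phi11 p v : U p -> tangent p v -> re_form phi11 p v = - (alpha p * f1 p v).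
Proof.
move=> Up tv; have [_ h _] := hCC; have := h _ _ Up tv.
rewrite /re_form; case: (phi11 p v) => x y /= -[]; lra.
Qed.

Let g := fun (q : M) v => f2 q v - alpha q * th q v.

Lemma th1_frame p : U p ->
  [/\ g p (e1 p) = 0, g p (e2 p) = 1 & g p (T p) = - alpha p].
Proof.
move=> Up; rewrite /g theta_e1 // theta_e2 // theta_T //.
by have [_ [-> -> ->]] := dual_values Up; split; ring.
Qed.

Let fg : form1 U g.
Proof.
split=> [p Up a v u tv tu|O X oO OU vX].
  by rewrite /g (form1L ff2 Up) // (form1L fth Up) //; ring.
have sf := form_smooth oO (form1_sub OU ff2) vX.
have st := form_smooth oO (form1_sub OU fth) vX.
exact: (smooth_onB oO sf (smooth_onM oO (smooth_on_sub OU halpha) st)).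
Qed.

Section CCAtPoint.
Variables (p : M) (Up : U p).
Let t1 := frame_t1 Up.
Let t2 := frame_t2 Up.
Let tT := frame_tT Up.

Let at_ f : smooth_on U f -> smooth_at p f.
Proof. exact: (smooth_on_at hU ^~ Up). Qed.

Let df1_12 : d1 f1 e1 e2 p = H p.
Proof.
rewrite (d1_12 Up ff1).
rewrite (tangent_cst_on hU Up t1 (c := 0)); last by move=> q /dual_values[[]].
rewrite (tangent_cst_on hU Up t2 (c := 1)); last by move=> q /dual_values[[]].
by have [[-> -> ->] _] := dual_values Up; ring.
Qed.

Let df1_2T : d1 f1 e2 T p = a2 p - w p.
Proof.
rewrite (d1_2T Up ff1).
rewrite (tangent_cst_on hU Up t2 (c := 0)); last by move=> q /dual_values[[]].
rewrite (tangent_cst_on hU Up tT (c := 0)); last by move=> q /dual_values[[]].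
by have [[-> -> _] _] := dual_values Up; ring.
Qed.

Let dg_12 : d1 g e1 e2 p = K p - 2 * alpha p.
Proof.
rewrite (d1_12 Up fg).
rewrite (tangent_cst_on hU Up t1 (c := 1)); last by move=> q /th1_frame[].
rewrite (tangent_cst_on hU Up t2 (c := 0)); last by move=> q /th1_frame[].
by have [-> -> ->] := th1_frame Up; ring.
Qed.

Let dg_1T : d1 g e1 T p = - e1 p alpha + w p + a2 p.
Proof.
rewrite (d1_1T Up fg) (tangent_eq_on hU Up t1 (g := fun q => - alpha q)); last first.
  by move=> q /th1_frame[].
rewrite (tangent_cst_on hU Up tT (c := 0)); last by move=> q /th1_frame[].
rewrite (tangentN t1 (at_ halpha)).
by have [-> -> _] := th1_frame Up; ring.
Qed.

Lemma first_structure_equations : [/\ lam p (e1 p) = H p, lam p (e2 p) = K p - 3 * alpha p,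
  lam p (T p) = w p - a2 p - alpha p * lam p (e2 p) - mu p (e2 p) &
  nu p (e1 p) = lam p (T p) - alpha p ^+ 2 + e1 p alpha - w p - a2 p].
Proof.
have [A1 A2 _] := cartan_chern_real hCC v1 v2 Up.
have [B1 _ _] := cartan_chern_real hCC v2 vT Up.
have [_ C2 _] := cartan_chern_real hCC v1 vT Up.
have r1 := re_phi11 Up t1; have r2 := re_phi11 Up t2; have rT := re_phi11 Up tT.
have [[x1 x2 xT] _] := dual_values Up; have [g1 g2 gT] := th1_frame Up.
have {A1}A1 := etrans (esym df1_12) A1; have {A2}A2 := etrans (esym dg_12) A2.
have {B1}B1 := etrans (esym df1_2T) B1; have {C2}C2 := etrans (esym dg_1T) C2.
move: A1 A2 B1 C2; rewrite /wedge r1 r2 rT.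
rewrite (_ : re_form th1 = f1) // (_ : im_form th1 = g) //.
rewrite theta_e1 // theta_e2 // theta_T // x1 x2 xT g1 g2 gT; split; lra.
Qed.

End CCAtPoint.

(** The equation for [d lam] on [(e1, e2)] closes the system: the terms with
    [e1 alpha] and with [omega e2] cancel, and what is left is linear in [lam T]. *)
Lemma im_phi11_T p : U p -> lam p (T p) = w p + 3 / 2 * alpha p ^+ 2 + W p / 4.
Proof.
move=> Up.
have t1 := frame_t1 Up; have t2 := frame_t2 Up.
have at_ f : smooth_on U f -> smooth_at p f by exact: (smooth_on_at hU ^~ Up).
have [_ _ D] := cartan_chern_real hCC v1 v2 Up.
have [L1 L2 LT N1] := first_structure_equations Up.
have [[x1 x2 xT] _] := dual_values Up; have [g1 g2 gT] := th1_frame Up.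
have sK := frame_smooth fom v2.
have dom := hW Up; rewrite (d1_12 Up fom) in dom.
move: D; rewrite (d1_12 Up flam) /wedge.
rewrite (_ : re_form th1 = f1) // (_ : im_form th1 = g) //.
rewrite (tangent_eq_on hU Up t1 (g := fun q => K q - 3 * alpha q)); last first.
  by move=> q /first_structure_equations[].
rewrite (tangent_eq_on hU Up t2 (g := fun q => H q)); last first.
  by move=> q /first_structure_equations[].
rewrite (tangentB t1 (at_ _ sK) (at_ _ (smooth_onZ 3 hU halpha))).
rewrite (tangentZ 3 t1 (at_ _ halpha)) x1 x2 g1 g2.
rewrite L1 L2 in LT N1 *; lra.
Qed.

Lemma cartan_chern_h10 p : U p ->
  nu p (e1 p) = e1 p alpha + alpha p ^+ 2 / 2 - a2 p + W p / 4.
Proof.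
by move=> Up; have [_ _ _ ->] := first_structure_equations Up; rewrite im_phi11_T //; field.
Qed.

(** [nu (T + alpha e2)] is obtained from [d lam (e2, T)], which the structure
    equation makes three times as large.  The derivative of [alpha] along [T]
    comes from [lam e2 = omega e2 - 3 alpha]; the terms [alpha (e2 alpha)] coming
    from [lam T] account for the component along [e2]. *)
Lemma cartan_chern_h00 p : U p -> nu p (T p + alpha p *: e2 p) =
  T p alpha + alpha p * e2 p alpha + e2 p W / 12
  + (e1 p a1 - e2 p a2 + 2 * H p * a2 p + 2 * K p * a1 p) / 3 - alpha p * a1 p.
Proof.
move=> Up.
have t2 := frame_t2 Up; have tT := frame_tT Up.
have at_ f : smooth_on U f -> smooth_at p f by exact: (smooth_on_at hU ^~ Up).
have fnu : form1 U nu by case: hCC => -[_ [_ ?] _].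
rewrite (form1D fnu Up) ?(form1Z fnu Up) //; last exact: tangent_scale.
have [_ _ D] := cartan_chern_real hCC v2 vT Up.
have [L1 L2 LT N1] := first_structure_equations Up.
have [[x1 x2 xT] _] := dual_values Up; have [g1 g2 gT] := th1_frame Up.
have sK := frame_smooth fom v2; have sw := frame_smooth fom vT.
have sW4 := smooth_onZ (4^-1) hU smooth_curvature.
have sal2 := smooth_onM hU halpha halpha.
have B := bianchi Up; rewrite (d1_2T Up fom) in B.
move: D; rewrite (d1_2T Up flam) /wedge.
rewrite (_ : re_form th1 = f1) // (_ : im_form th1 = g) //.
rewrite (tangent_eq_on hU Up t2 (g := fun q => w q +
    (3 / 2 * (alpha q * alpha q) + 4^-1 * W q))); last first.
  by move=> q Uq; rewrite im_phi11_T //; field.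
rewrite (tangent_eq_on hU Up tT (g := fun q => K q - 3 * alpha q)); last first.
  by move=> q /first_structure_equations[].
rewrite (tangentB tT (at_ _ sK) (at_ _ (smooth_onZ 3 hU halpha))).
rewrite (tangentZ 3 tT (at_ _ halpha)).
have sm := smooth_onZ (3 / 2) hU sal2.
rewrite (tangentD t2 (at_ _ sw) (at_ _ (smooth_onD hU sm sW4))).
rewrite (tangentD t2 (at_ _ sm) (at_ _ sW4)).
rewrite (tangentZ _ t2 (at_ _ sal2)) (tangentZ _ t2 (at_ _ smooth_curvature)).
rewrite (tangentM t2 (at_ _ halpha) (at_ _ halpha)).
rewrite x2 xT g2 gT L1 L2; lra.
Qed.

End SecondFundamentalForm.
End AdaptedFrame.

(** * The area elements *)

Theorem theorem1 (R : realType) (M : manifold R 3) (P : pseudohermitian M)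
  (S : set M) (hS : hypersurface S) (hns : nonsingular P S)
  (T : field M) (hT : reeb P T)
  (nabla : field M -> field M -> field M) (hnabla : tanaka_webster P T nabla)
  (U : set M) (hU : open U)
  (e1 e2 : field M) (he : orthonormal_frame P U e1 e2)
  (f1 f2 : preform1 M) (hf : dual_coframe U T e1 e2 f1 f2)
  (omega : preform1 M) (homega : connection_form U nabla e1 e2 omega)
  (a1 a2 : M -> R) (ha : torsion_coefficients U nabla T e1 e2 a1 a2)
  (W : M -> R) (hW : forall p, U p -> d1 omega e1 e2 p = - 2 * W p)
  (alpha : M -> R) (halpha : smooth_on U alpha)
  (he1 : forall p, (S `&` U) p -> tangent_to S p (e1 p))
  (hTalpha : forall p, (S `&` U) p ->
     tangent_to S p (T p + alpha p *: e2 p))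
  (dA1 dA2 : M -> tvec M -> tvec M -> R)
  (hdA : CR_area_elements P S U
           (fun p v => f1 p v +i* (f2 p v - alpha p * theta P p v))
           (fun p v => - 2 * alpha p * f1 p v) dA1 dA2) :
  let H := fun p => omega p (e1 p) in
  let V := fun p => T p + alpha p *: e2 p in
  let A11 := fun p => a1 p +i* a2 p in
  let Aup := fun p => (A11 p)^*%C in
  let Z := Z1 e1 e2 in
  let omega11 := fun p v => 'i%C * (omega p v)%:C in
  let dW := fun p => cder (bar_field Z) (fun q => (W q)%:C) p in
  let dAup := fun p => cder Z Aup p + 2 * ceval omega11 Z p * Aup p in
  let B := fun p => e1 p alpha + alpha p ^+ 2 / 2 + W p / 4 in
  (forall p v w, (S `&` U) p -> tangent_to S p v -> tangent_to S p w ->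
     dA1 p v w =
       `|e1 p alpha + alpha p ^+ 2 / 2 - complex.Im (A11 p) + W p / 4
         + H p ^+ 2 / 6| `^ (3 / 2) * wedge (theta P) f1 p v w /\
     dA2 p v w =
       (V p alpha
        + 2 / 3 * (e1 p alpha + alpha p ^+ 2 / 2 - complex.Im (A11 p) + W p / 4)
            * H p
        + 2 / 27 * H p ^+ 3
        + complex.Im (6^-1 * dW p + 2 * 'i%C / 3 * dAup p)
        - alpha p * complex.Re (Aup p)) * wedge (theta P) f1 p v w) /\
  (is_heisenberg P \/ is_sphere P ->
     (forall p v w, (S `&` U) p -> tangent_to S p v -> tangent_to S p w ->
       dA1 p v w = `|B p + H p ^+ 2 / 6| `^ (3 / 2)
                   * wedge (theta P) f1 p v w /\
       dA2 p v w = (V p alpha + 2 / 3 * B p * H p + 2 / 27 * H p ^+ 3)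
                   * wedge (theta P) f1 p v w) /\
     (is_heisenberg P -> forall p, U p -> W p = 0) /\
     (is_sphere P -> forall p, U p -> W p = 2)).
Proof.
move=> H V A11 Aup Z omega11 dW dAup B.
have [phi11 [phi1 [psi [h11 [h10 [h00 [hadm hadapt hCC hII hA]]]]]]] := hdA.
have homU : form1 U omega by case: homega.
have c6 : 6^-1 = 6^-1 +i* 0 :> R[i] by rewrite complexr0 fmorphV rmorph_nat.
have c3 : 3^-1 = 3^-1 +i* 0 :> R[i] by rewrite complexr0 fmorphV rmorph_nat.
have c2 : 2 = 2 +i* 0 :> R[i] by rewrite complexr0 rmorph_nat.
have dE p : U p -> complex.Im (6^-1 * dW p + 2 * 'i%C / 3 * dAup p) = e2 p W / 12
    + (e1 p a1 - e2 p a2 + 2 * H p * a2 p + 2 * omega p (e2 p) * a1 p) / 3.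
  move=> Up; have t1 := frame_t1 he Up; have t2 := frame_t2 he Up.
  have s2 := smooth_on_at hU (smooth_a2 hT hnabla hU he hf homega ha) Up.
  rewrite /dW /dAup /cder /ceval /omega11 /Aup /A11 /Z /Z1 /bar_field /H c6 c3 c2.
  have o1 : omega p (2^-1 *: e1 p) = 2^-1 * omega p (e1 p) by rewrite (form1Z homU Up).
  have o2 : omega p (- (2^-1 *: e2 p)) = - (2^-1 * omega p (e2 p)).
    by rewrite (form1N homU Up) ?(form1Z homU Up) //; exact: tangent_scale.
  rewrite /= o1 o2 !fctE /GRing.scale /= /GRing.scale /=.
  rewrite !(tangent_cst 0 t2) !(tangent_cst 0 t1) (tangentN t1 s2) (tangentN t2 s2).
  by field.
(* [e1] and [T + alpha e2] span the tangent plane, and there [f1] and [theta]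
   are the dual coordinates *)
have coef p : (S `&` U) p -> [/\ h11 p = H p,
    h10 p = e1 p alpha + alpha p ^+ 2 / 2 - a2 p + W p / 4 &
    h00 p = T p alpha + alpha p * e2 p alpha + e2 p W / 12
      + (e1 p a1 - e2 p a2 + 2 * H p * a2 p + 2 * omega p (e2 p) * a1 p) / 3
      - alpha p * a1 p].
  move=> SUp; have [Sp Up] := SUp.
  have [[x1 x2 xT] _] := dual_values hf Up.
  have t2 := frame_t2 he Up; have tT := frame_tT hT Up.
  have ff1 : form1 U f1 by case: hf.
  have [] := hII p _ SUp (he1 p SUp).
  have [] := hII p _ SUp (hTalpha p SUp).
  rewrite (cartan_chern_h00 hT hnabla hU he hf homega ha hW halpha hCC Up).
  rewrite (cartan_chern_h10 hT hnabla hU he hf homega ha hW halpha hCC Up).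
  have [-> _ _ _] := first_structure_equations hT hnabla hU he hf homega ha halpha hCC Up.
  rewrite /re_form /= (form1D ff1 Up) ?(form1Z ff1 Up) //; last exact: tangent_scale.
  have fth := frame_th P U.
  rewrite (form1D fth Up) ?(form1Z fth Up) //; last exact: tangent_scale.
  rewrite x1 x2 xT (theta_e1 he Up) (theta_e2 he Up) (theta_T hT).
  by move=> _ E00 E11 E10; rewrite -/(H p) in E00 E11 *; split; lra.
have area p v u : (S `&` U) p -> tangent_to S p v -> tangent_to S p u ->
    dA1 p v u = `|e1 p alpha + alpha p ^+ 2 / 2 - complex.Im (A11 p) + W p / 4
         + H p ^+ 2 / 6| `^ (3 / 2) * wedge (theta P) f1 p v u /\
    dA2 p v u =
       (V p alpha
        + 2 / 3 * (e1 p alpha + alpha p ^+ 2 / 2 - complex.Im (A11 p) + W p / 4)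
            * H p
        + 2 / 27 * H p ^+ 3
        + complex.Im (6^-1 * dW p + 2 * 'i%C / 3 * dAup p)
        - alpha p * complex.Re (Aup p)) * wedge (theta P) f1 p v u.
  move=> SUp tv tu; have [-> ->] := hA _ _ _ SUp tv tu; have [Sp Up] := SUp.
  rewrite dE // /V /Aup /A11 /= !fctE.
  by have [-> -> ->] := coef p SUp; split=> //; rewrite /GRing.scale /=; congr (_ * _); field.
(* constant curvature and zero torsion on all of [U] kill the derivative terms *)
have flat : is_heisenberg P \/ is_sphere P -> forall p, U p ->
    [/\ a1 p = 0, a2 p = 0 & exists c, forall q, U q -> W q = c].
  move=> hm p Up.
  have [hH|hSph] := hm.
    have c q Uq := heisenberg_curvature hT hnabla hU he homega ha (p := q) hH Uq.
    have [-> -> _] := c p Up; split=> //; exists 0 => q Uq.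
    by have [_ _] := c q Uq; rewrite hW //; lra.
  have c q Uq := sphere_curvature hT hnabla hU he homega ha (p := q) hSph Uq.
  have [-> -> _] := c p Up; split=> //; exists 2 => q Uq.
  by have [_ _] := c q Uq; rewrite hW //; lra.
split; first by [].
move=> hm; split; last split.
- move=> p v u SUp tv tu; have [-> ->] := area p v u SUp tv tu; have [Sp Up] := SUp.
  have t1 := frame_t1 he Up; have t2 := frame_t2 he Up.
  have [a10 a20 [c Wc]] := flat hm p Up.
  rewrite dE // (tangent_cst_on hU Up t2 Wc).
  rewrite (tangent_cst_on hU Up t1 (f := a1) (c := 0)); last by move=> q /(flat hm)[].
  rewrite (tangent_cst_on hU Up t2 (f := a2) (c := 0)); last by move=> q /(flat hm)[].
  by rewrite /= a10 a20 !(mulr0, mul0r, subr0, addr0) /B; split.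
- move=> hH p Up.
  have [_ _] := heisenberg_curvature hT hnabla hU he homega ha hH Up.
  by rewrite hW //; lra.
- move=> hSph p Up.
  have [_ _] := sphere_curvature hT hnabla hU he homega ha hSph Up.
  by rewrite hW //; lra.
Qed.
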